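(* There exists a trigonometric series $$\sum_{k=-\infty}^{\infty} C_k e^{ikx}\quad\text{with}\quad \sum_{k=-\infty}^{\infty}|C_k|^q<\infty\ \text{ for all } q>2$$ (with complex coefficients $C_k$, $k\in\mathbb{Z}$) such that for every number $\varepsilon>0$ there is a measurable weight function $\mu:[0,2\pi]\to\mathbb{R}$ with $0<\mu(x)\le 1$ for all $x\in[0,2\pi]$ and $$\left|\{x\in[0,2\pi]:\mu(x)\neq 1\}\right|<\varepsilon,$$ for which the series $\sum_{k=-\infty}^{\infty} C_k e^{ikx}$ is universal in $L^1_\mu[0,2\pi]$ with respect to rearrangements. (The series does not depend on $\varepsilon$; the weight $\mu$ may depend on $\varepsilon$.)
   Context: $|A|$ denotes the Lebesgue measure of a measurable set $A$. For a measurable function $\mu$ on $[0,2\pi]$ with $0<\mu(x)\le 1$, $L^1_\mu[0,2\pi]$ is the Banach space of measurable (complex-valued) functions $f$ on $[0,2\pi]$ (modulo equality a.e.) with $\|f\|=\int_0^{2\pi}|f(x)|\mu(x)\,dx<\infty$. A series $\sum f_k$ of elements of a Banach space $X$ is said to be universal in $X$ with respect to rearrangements if for any $f\in X$ the members of the series can be rearranged so that the rearranged series converges to $f$ in the norm of $X$. For a series $\sum_{k=-\infty}^\infty C_ke^{ikx}$ indexed by $\mathbb{Z}$ this means: for every $f\in X$ there is a bijection $\sigma:\{1,2,3,\dots\}\to\mathbb{Z}$ such that $\sum_{j=1}^{n} C_{\sigma(j)}e^{i\sigma(j)x}\to f$ in the norm of $X$ as $n\to\infty$. *)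

(* Defs.v *)
From HB Require Import structures.
From mathcomp Require Import all_boot all_order all_algebra.
From mathcomp Require Import complex.
From mathcomp Require Import all_classical all_reals all_analysis.

Set Implicit Arguments.
Unset Strict Implicit.
Unset Printing Implicit Defensive.

Import Order.TTheory GRing.Theory Num.Theory.
Import numFieldNormedType.Exports.
Import ComplexField.Normc.

Local Open Scope classical_set_scope.
Local Open Scope ring_scope.

Definition period {R : realType} : set R := `[0, 2 * pi].

Definition cis {R : realType} (t : R) : R[i] := Complex (cos t) (sin t).

Definition trig_term {R : realType} (C : int -> R[i]) (k : int) : R -> R[i] :=
  fun x => C k * cis (k%:~R * x).

(* MathComp-Analysis puts no sigma-algebra on [R[i]]; measurability for the
   Borel sets of the plane is that of the real and imaginary parts. *)
Definition cmeasurable_fun {R : realType} (D : set R) (f : R -> R[i]) :=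
  measurable_fun D (fun x => complex.Re (f x)) /\
  measurable_fun D (fun x => complex.Im (f x)).

Definition L1w_norm {R : realType} (mu : R -> R) (f : R -> R[i]) : \bar R :=
  (\int[lebesgue_measure]_(x in period) ((normc (f x) * mu x)%R)%:E)%E.

(* The elements of L^1_mu[0,2pi], given by representatives rather than by
   classes modulo a.e. equality. The sigma-algebra on [R] is the Borel one:
   every Lebesgue measurable function is a.e. equal to a Borel one, so the
   classes are the same. Values outside [period] are irrelevant. *)
Definition L1w {R : realType} (mu : R -> R) : set (R -> R[i]) :=
  [set f | cmeasurable_fun period f /\ (L1w_norm mu f < +oo)%E].

(* [X] is a space of representatives of the elements of a Banach space with norm
   [N]; convergence for the seminorm [N] is convergence of the classes. *)
Definition universal_wrt_rearrangements {R : realType} {V : zmodType}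
    (X : set V) (N : V -> \bar R) {I : Type} (u : I -> V) : Prop :=
  forall f : V, X f ->
    exists sigma : nat -> I, bijective sigma /\
      (fun n : nat => N (\sum_(j < n) u (sigma j) - f)) @ \oo --> 0%E.

(* Main.v *)
Require Import Defs.
From mathcomp Require Import all_boot all_order all_algebra.
From mathcomp Require Import complex.
From mathcomp Require Import all_classical all_reals all_analysis.
From mathcomp Require Import measurable_realfun.
From mathcomp Require Import ring lra zify.
Import Order.TTheory GRing.Theory Num.Theory.
Import numFieldNormedType.Exports.
Import ComplexField.Normc.
Local Open Scope classical_set_scope.
Local Open Scope ring_scope.

Set Implicit Arguments.
Unset Strict Implicit.
Unset Printing Implicit Defensive.

(** The series is a concatenation of finite blocks with disjoint spectra. The
    block of a target [c * cis (l x)] is [c * cis (l x) * (1 - P)], where [P] is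
    a Riesz product [prod_k (1 + a * cos (n_k x))] with [n_k = n0 * 3^k], with
    [N] factors, [a] small and [S = N * a^2] large. Three facts make it work.

    - The coefficients of [1 - P] are, up to sign, products of factors [a / 2].
      They are at most [a], and the sum of their squares is at most
      [exp (S / 2)], so when [a] tends to 0 with [S] fixed their [q]-th powers
      have a sum tending to 0 for every [q > 2] ([riesz_block], [block_exists]).
    - [P] is nonnegative with mean 1, but its logarithm has a mean of order
      [- S] and a standard deviation of order [sqrt S]. Hence [P] is tiny
      outside a small set, where the block is close to its target
      ([riesz_prod_le_exp], [riesz_prod_large]).
    - All the partial sums of a block are bounded by [6 * pi * |c|] in the
      unweighted norm: those that end with a full factor are Riesz products up to
      a constant, and the terms that follow the last full factor have a bounded
      mean square ([L1_riesz_tail_prefix]).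

    The [n]-th block is built so that its error [e_n] exceeds [2^-n] on a set of
    measure at most [2^-n] only. Given [eps], the blocks from some rank on
    serve to approximate, and the weight is the reciprocal of
    [1 + sum_n (2^n * e_n - 1)^+]: it is 1 outside a set of measure less than
    [eps], and almost everywhere it brings every [e_n] below [2^-n]
    ([taming_weightP]). The other blocks are only used term by term.

    For the rearrangement, the residual [g] still to be approximated is close in
    the weighted norm to a finite sum [p] of targets ([targets_dense]). The
    partial sums of the blocks of [p] are controlled by the size of the
    coefficients of [p] and not by the norm of [p]; but [p] is [K] times
    [p / K], every target occurs infinitely often, and running [K] times through
    the blocks of [p / K] divides that loss by [K] ([steer_targets]). So the
    residual can be made small along partial sums of size comparable with its
    norm ([steer_X]). Such moves alternate with the insertion of the integers in
    turn; as the coefficients tend to 0 the rearranged series converges, and it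
    exhausts the integers ([rearrangement]). *)

(** * Trigonometric sums over a period *)

Section TrigSums.
Context {R : realType}.
Implicit Types (s : seq (int * R[i])) (c : R[i]) (x : R).

Definition trig_sum s : R -> R[i] :=
  fun x => \sum_(p <- s) p.2 * cis (p.1%:~R * x).

Lemma trig_sum_nil : trig_sum [::] = 0.
Proof. by apply/funext => x; rewrite /trig_sum big_nil. Qed.

Lemma trig_sum_cons p s x :
  trig_sum (p :: s) x = p.2 * cis (p.1%:~R * x) + trig_sum s x.
Proof. by rewrite /trig_sum big_cons. Qed.

Lemma trig_sum_cat s1 s2 x : trig_sum (s1 ++ s2) x = trig_sum s1 x + trig_sum s2 x.
Proof. by rewrite /trig_sum big_cat. Qed.

Lemma cisD (a b : R) : cis (a + b) = cis a * cis b.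
Proof.
by rewrite /cis cosD sinD; apply/eqP; rewrite eq_complex /= addrC;
  apply/andP; split; apply/eqP; ring.
Qed.

Lemma conj_cis (a : R) : conjc (cis a) = cis (- a).
Proof. by rewrite /cis /= cosN sinN. Qed.

Lemma cis_conj (a : R) : cis a + cis (- a) = (2 * cos a)%:C%C.
Proof.
by rewrite /cis cosN sinN; apply/eqP; rewrite eq_complex /= subrr eqxx andbT;
  apply/eqP; ring.
Qed.

Lemma normc_sqr (z : R[i]) : normc z ^+ 2 = complex.Re z ^+ 2 + complex.Im z ^+ 2.
Proof. by case: z => a b /=; rewrite sqr_sqrtr // addr_ge0 ?sqr_ge0. Qed.

Lemma normc_ge0 (z : R[i]) : 0 <= normc z.
Proof. by case: z => a b /=; exact: sqrtr_ge0. Qed.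

Lemma normc_cis (a : R) : normc (cis a) = 1.
Proof. by rewrite /cis /= cos2Dsin2 sqrtr1. Qed.

Lemma normc_real (a : R) : normc a%:C%C = `|a|.
Proof. by rewrite /= expr0n addr0 sqrtr_sqr. Qed.

Lemma normc_Re (z : R[i]) : `|complex.Re z| <= normc z.
Proof.
rewrite -(@ler_pXn2r _ 2) ?nnegrE ?normc_ge0 //.
by rewrite normc_sqr real_normK ?num_real // lerDl sqr_ge0.
Qed.

Lemma normc_Im (z : R[i]) : `|complex.Im z| <= normc z.
Proof.
rewrite -(@ler_pXn2r _ 2) ?nnegrE ?normc_ge0 //.
by rewrite normc_sqr real_normK ?num_real // lerDr sqr_ge0.
Qed.

Definition ccontinuous (f : R -> R[i]) :=
  continuous (fun x => complex.Re (f x)) /\ continuous (fun x => complex.Im (f x)).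

Lemma ccontinuousD f g : ccontinuous f -> ccontinuous g -> ccontinuous (fun x => f x + g x).
Proof.
move=> [f1 f2] [g1 g2]; split=> x.
- have -> : (fun x => complex.Re (f x + g x)) =
    (fun x => complex.Re (f x) + complex.Re (g x)).
    by apply/funext => y; case: (f y) (g y) => [? ?] [].
  exact: cvgD (f1 x) (g1 x).
- have -> : (fun x => complex.Im (f x + g x)) =
    (fun x => complex.Im (f x) + complex.Im (g x)).
    by apply/funext => y; case: (f y) (g y) => [? ?] [].
  exact: cvgD (f2 x) (g2 x).
Qed.

Lemma ccontinuous_term k c : ccontinuous (fun x => c * cis (k%:~R * x)).
Proof.
case: c => a b; rewrite /cis; split=> /= x.
- apply: cvgB; apply: cvgM; try exact: cvg_cst.
  + by apply: continuous_comp; [apply: mulrl_continuous|exact: continuous_cos].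
  + by apply: continuous_comp; [apply: mulrl_continuous|exact: continuous_sin].
- apply: cvgD; apply: cvgM; try exact: cvg_cst.
  + by apply: continuous_comp; [apply: mulrl_continuous|exact: continuous_sin].
  + by apply: continuous_comp; [apply: mulrl_continuous|exact: continuous_cos].
Qed.

Lemma ccontinuous_trig_sum s : ccontinuous (trig_sum s).
Proof.
elim: s => [|p s IH].
  by rewrite trig_sum_nil; split => x; exact: cvg_cst.
have -> : trig_sum (p :: s) = (fun x => p.2 * cis (p.1%:~R * x) + trig_sum s x).
  by apply/funext => x; rewrite trig_sum_cons.
exact: ccontinuousD (ccontinuous_term _ _) IH.
Qed.

Lemma continuous_normc_sqr f : ccontinuous f -> continuous (fun x => normc (f x) ^+ 2).
Proof.
move=> [c1 c2] x.
have -> : (fun x => normc (f x) ^+ 2) = (fun x =>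
   complex.Re (f x) * complex.Re (f x) + complex.Im (f x) * complex.Im (f x)).
  by apply/funext => y; rewrite normc_sqr !expr2.
by apply: cvgD; apply: cvgM; (exact: c1 || exact: c2).
Qed.

Lemma continuous_normc f : ccontinuous f -> continuous (fun x => normc (f x)).
Proof.
move=> cf x.
have -> : (fun x => normc (f x)) = (fun x => Num.sqrt (normc (f x) ^+ 2)).
  by apply/funext => y; rewrite sqrtr_sqr ger0_norm // normc_ge0.
by apply: continuous_comp; [exact: continuous_normc_sqr|exact: sqrt_continuous].
Qed.

Definition pint (h : R -> R) : R := (\int[lebesgue_measure]_(x in period) h x)%R.

Lemma measurable_period : measurable (@period R : set R).
Proof. exact: measurable_itv. Qed.

Lemma period_lt : (0 : R) < 2 * pi.
Proof. by rewrite mulr_gt0 ?pi_gt0. Qed.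

Lemma lebesgue_period : lebesgue_measure (@period R) = (2 * pi)%:E.
Proof. by rewrite /period lebesgue_measure_itv /= lte_fin period_lt oppr0 adde0. Qed.

Lemma continuous_pintegrable (h : R -> R) : continuous h ->
  lebesgue_measure.-integrable (@period R) (EFin \o h).
Proof.
move=> ch; apply: (continuous_compact_integrable (segment_compact (a:=0) (b:=2*pi))).
by apply: continuous_subspaceT.
Qed.

Lemma pintD (f g : R -> R) : continuous f -> continuous g ->
  pint (fun x => f x + g x) = pint f + pint g.
Proof.
move=> cf cg; apply: RintegralD; [exact: measurable_period|exact: continuous_pintegrable..].
Qed.

Lemma pintZ (r : R) (f : R -> R) : continuous f -> pint (fun x => r * f x) = r * pint f.
Proof.
move=> cf; apply: RintegralZl; [exact: measurable_period|exact: continuous_pintegrable].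
Qed.

Lemma pint_cst (r : R) : pint (fun _ => r) = 2 * pi * r.
Proof.
rewrite /pint Rintegral_cst; [|exact: measurable_period].
by rewrite mulrC; congr (_ * r); exact: (congr1 fine lebesgue_period).
Qed.

Lemma integral_pint h : continuous h ->
  (\int[lebesgue_measure]_(x in period) (h x)%:E)%E = (pint h)%:E.
Proof.
move=> ch; rewrite /pint /Rintegral fineK //.
apply: integrable_fin_num; [exact: measurable_period|exact: continuous_pintegrable].
Qed.

Lemma continuous_scale (a : R) : continuous (fun x : R => a * x).
Proof. exact: mulrl_continuous. Qed.

Lemma is_derive_scale (a x : R) : is_derive x 1 (fun y : R => a * y) a.
Proof.
have := @is_deriveZ R R R (@id R) a x 1 1 (is_derive_id _ _).
by rewrite /GRing.scale /= mulr1.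
Qed.

Lemma sin_2piZ (k : int) : sin (k%:~R * (2 * pi)) = 0 :> R.
Proof.
have nat n : sin (n%:R * (2 * pi)) = 0 :> R.
  have := periodicn (@sinD2pi R) n 0; rewrite add0r sin0 => <-.
  by congr sin; rewrite mulr_natl mulr_natl.
by case: k => n; [exact: nat|rewrite NegzE mulrNz mulNr sinN nat oppr0].
Qed.

Lemma cos_2piZ (k : int) : cos (k%:~R * (2 * pi)) = 1 :> R.
Proof.
have nat n : cos (n%:R * (2 * pi)) = 1 :> R.
  have := periodicn (@cosD2pi R) n 0; rewrite add0r cos0 => E.
  by rewrite mulr_natl [2 * _]mulr_natl.
by case: k => n; [exact: nat|rewrite NegzE mulrNz mulNr cosN nat].
Qed.

Lemma FTC2_period (f F : R -> R) : continuous f ->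
  (forall x, is_derive x 1 F (f x)) -> pint f = F (2 * pi) - F 0.
Proof.
move=> cf dF; rewrite /pint /Rintegral (@continuous_FTC2 _ f F) //.
- exact: period_lt.
- exact: continuous_subspaceT.
- have cF : continuous F.
    by move=> x; apply: differentiable_continuous; apply/derivable1_diffP; case: (dF x).
  split.
  + by move=> x _; case: (dF x).
  + by apply: cvg_at_right_filter; exact: cF.
  + by apply: cvg_at_left_filter; exact: cF.
- by move=> x _; rewrite derive1E; case: (dF x).
Qed.

Lemma continuous_cos_scale (a : R) : continuous (fun x : R => cos (a * x)).
Proof.
by move=> x; apply: continuous_comp; [exact: continuous_scale|exact: continuous_cos].
Qed.

Lemma continuous_sin_scale (a : R) : continuous (fun x : R => sin (a * x)).
Proof.
by move=> x; apply: continuous_comp; [exact: continuous_scale|exact: continuous_sin].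
Qed.

Lemma pint_cos (k : int) : k != 0 -> pint (fun x => cos (k%:~R * x)) = 0.
Proof.
move=> k0; have k0' : (k%:~R : R) != 0 by rewrite intr_eq0.
have dF x : is_derive x 1 (fun x => k%:~R^-1 * sin (k%:~R * x)) (cos (k%:~R * x)).
  have := @is_derive1_comp R sin (fun y => k%:~R * y) x _ _
    (is_derive_sin (k%:~R * x)) (is_derive_scale k%:~R x).
  move/(@is_deriveZ R R R _ (k%:~R^-1) x 1).
  by rewrite /GRing.scale /= mulrCA mulVf // mulr1.
rewrite (FTC2_period (@continuous_cos_scale _) dF).
by rewrite sin_2piZ !mulr0 sin0 mulr0 subrr.
Qed.

Lemma pint_sin (k : int) : pint (fun x => sin (k%:~R * x)) = 0.
Proof.
have [->|k0] := eqVneq k 0.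
  have -> : (fun x => sin (0%:~R * x)) = (fun _ : R => 0 : R).
    by apply/funext => x; rewrite mul0r sin0.
  by rewrite pint_cst mulr0.
have k0' : (k%:~R : R) != 0 by rewrite intr_eq0.
have dF x : is_derive x 1 (fun x => (- k%:~R^-1) * cos (k%:~R * x)) (sin (k%:~R * x)).
  have := @is_derive1_comp R cos (fun y => k%:~R * y) x _ _
    (is_derive_cos (k%:~R * x)) (is_derive_scale k%:~R x).
  move/(@is_deriveZ R R R _ (- k%:~R^-1) x 1).
  by rewrite /GRing.scale /= mulrA mulrNN mulrAC mulVf // mul1r.
rewrite (FTC2_period (@continuous_sin_scale _) dF).
by rewrite cos_2piZ mulr0 cos0 subrr.
Qed.

Lemma pint_Re_term (k : int) c : k != 0 ->
  pint (fun x => complex.Re (c * cis (k%:~R * x))) = 0.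
Proof.
case: c => a b k0.
have -> : (fun x => complex.Re ((a +i* b)%C * cis (k%:~R * x))) =
   (fun x => a * cos (k%:~R * x) + (- b) * sin (k%:~R * x)).
  by apply/funext => x /=; rewrite mulNr.
rewrite pintD.
- rewrite pintZ; last exact: continuous_cos_scale.
  rewrite pintZ; last exact: continuous_sin_scale.
  by rewrite pint_cos // pint_sin !mulr0 addr0.
- by move=> x; apply: cvgM; [exact: cvg_cst|exact: continuous_cos_scale].
- by move=> x; apply: cvgM; [exact: cvg_cst|exact: continuous_sin_scale].
Qed.

Lemma pint_Re_trig_sum s : 0 \notin [seq p.1 | p <- s] ->
  pint (fun x => complex.Re (trig_sum s x)) = 0.
Proof.
elim: s => [|p s IH] /=.
  by rewrite trig_sum_nil pint_cst mulr0.
rewrite inE negb_or eq_sym => /andP[p0 s0].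
have -> : (fun x => complex.Re (trig_sum (p :: s) x)) =
  (fun x => complex.Re (p.2 * cis (p.1%:~R * x)) + complex.Re (trig_sum s x)).
  by apply/funext => x; rewrite trig_sum_cons raddfD.
rewrite pintD; [|exact: (ccontinuous_term _ _).1|exact: (ccontinuous_trig_sum _).1].
by rewrite pint_Re_term // IH // addr0.
Qed.

(** Multiplying by the conjugate of an exponential of another frequency leaves
    no constant term, hence the mixed terms of the square integrate to zero. *)
Lemma parseval s : uniq [seq p.1 | p <- s] ->
  pint (fun x => normc (trig_sum s x) ^+ 2) = 2 * pi * \sum_(p <- s) normc p.2 ^+ 2.
Proof.
have cn s' := continuous_normc_sqr (ccontinuous_trig_sum s').
elim: s => [|p s IH] /=.
  move=> _; rewrite big_nil mulr0.
  have -> : (fun x => normc (trig_sum [::] x) ^+ 2) = (fun _ => 0).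
    by apply/funext => x; rewrite trig_sum_nil normc0 expr0n.
  by rewrite pint_cst mulr0.
case/andP => ps us.
pose s' := [seq (q.1 - p.1, (conjc p.2 * q.2) *+ 2) | q <- s].
have E x : normc (trig_sum (p :: s) x) ^+ 2 =
    normc p.2 ^+ 2 + normc (trig_sum s x) ^+ 2 + complex.Re (trig_sum s' x).
  have -> : trig_sum s' x = (conjc (p.2 * cis (p.1%:~R * x)) * trig_sum s x) *+ 2.
    rewrite /trig_sum big_map mulr_sumr -sumrMnl; apply: eq_bigr => q _ /=.
    rewrite mulrnAl -!mulrA; congr (_ *+ 2).
    have -> : conjc (p.2 * cis (p.1%:~R * x)) = conjc p.2 * cis (- (p.1%:~R * x)).
      by rewrite -conj_cis; exact: rmorphM.
    rewrite -mulrA; congr (_ * _).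
    by rewrite mulrCA -cisD rmorphB /= mulrBl; congr (_ * cis _); rewrite addrC.
  have -> : normc p.2 ^+ 2 = normc (p.2 * cis (p.1%:~R * x)) ^+ 2.
    by rewrite normcM normc_cis mulr1.
  rewrite trig_sum_cons !normc_sqr mulr2n.
  by case: (p.2 * _) (trig_sum s x) => [a b] [a' b'] /=; ring.
have -> : (fun x => normc (trig_sum (p :: s) x) ^+ 2) = (fun x =>
   (normc p.2 ^+ 2 + normc (trig_sum s x) ^+ 2) + complex.Re (trig_sum s' x)).
  by apply/funext => x; rewrite E.
rewrite pintD; last exact: (ccontinuous_trig_sum _).1.
  rewrite (@pintD (fun _ => normc p.2 ^+ 2)) //; last by move=> x; exact: cvg_cst.
  rewrite IH // pint_cst big_cons pint_Re_trig_sum ?addr0 ?mulrDr //.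
  rewrite -map_comp; apply/mapP => -[q qs] /= /esym /eqP; rewrite subr_eq0 => /eqP qp.
  by move/negP: ps; apply; apply/mapP; exists q.
move=> x; apply: cvgD; [exact: cvg_cst|exact: cn].
Qed.

(** Cauchy-Schwarz on the period, in the form given by the inequality between
    the arithmetic and geometric means; no square root of the sum is taken. *)
Lemma pint_normc_le s t : 0 < t -> uniq [seq p.1 | p <- s] ->
  \sum_(p <- s) normc p.2 ^+ 2 <= t ^+ 2 ->
  (L1w_norm (fun _ => 1%R) (trig_sum s) <= (2 * pi * t)%:E)%E.
Proof.
move=> t0 us st.
have t2 : 0 < 2 * t by rewrite mulr_gt0.
pose h x := t / 2 + (2 * t)^-1 * normc (trig_sum s x) ^+ 2.
have cn := @continuous_normc_sqr (trig_sum s) (ccontinuous_trig_sum s).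
have cn' : continuous (fun x => (2 * t)^-1 * normc (trig_sum s x) ^+ 2).
  by move=> x; apply: cvgM; [exact: cvg_cst|exact: cn].
have ch : continuous h by move=> x; apply: cvgD; [exact: cvg_cst|exact: cn'].
apply: (@le_trans _ _ (pint h)%:E); last first.
  rewrite lee_fin pintD //; last by move=> x; exact: cvg_cst.
  rewrite (@pintZ (2 * t)^-1) // pint_cst parseval //.
  have : 2 * pi * ((2 * t)^-1 * \sum_(p <- s) normc p.2 ^+ 2) <= 2 * pi * (t / 2).
    rewrite ler_wpM2l ?(ltW period_lt) // mulrC ler_pdivrMr //.
    by apply: le_trans st _; rewrite le_eqVlt; apply/orP; left; apply/eqP; field.
  rewrite mulrCA -lerBrDl; move/le_trans; apply.
  by rewrite le_eqVlt; apply/orP; left; apply/eqP; field.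
rewrite -integral_pint //; apply: ge0_le_integral => //.
- exact: measurable_period.
- by move=> x _; rewrite lee_fin mulr1 normc_ge0.
- under eq_fun do rewrite mulr1.
  apply/measurable_EFinP/measurable_funTS; apply: continuous_measurable_fun.
  exact: continuous_normc (ccontinuous_trig_sum s).
- apply/measurable_EFinP/measurable_funTS; exact: continuous_measurable_fun.
- move=> x _; rewrite lee_fin mulr1 /h; set n := normc _.
  have -> : t / 2 + (2 * t)^-1 * n ^+ 2 = n + (2 * t)^-1 * (n - t) ^+ 2.
    by field; rewrite gt_eqF.
  by rewrite lerDl mulr_ge0 ?invr_ge0 ?(ltW t2) // sqr_ge0.
Qed.

(** * The weighted seminorm *)

Lemma cmeasurable_normc (f : R -> R[i]) :
  cmeasurable_fun period f -> measurable_fun period (fun x => normc (f x)).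
Proof.
move=> [m1 m2].
have -> : (fun x => normc (f x)) =
    Num.sqrt \o (fun x => complex.Re (f x) ^+ 2 + complex.Im (f x) ^+ 2).
  by apply/funext => x /=; case: (f x).
apply: measurableT_comp.
  by apply: continuous_measurable_fun => x; exact: sqrt_continuous.
by apply: measurable_funD; apply: measurable_funX.
Qed.

Lemma cmeasurable_funD (f g : R -> R[i]) : cmeasurable_fun period f ->
  cmeasurable_fun period g -> cmeasurable_fun period (f + g).
Proof.
move=> [f1 f2] [g1 g2]; split.
- have -> : (fun x => complex.Re ((f + g) x)) =
      (fun x => complex.Re (f x)) \+ (fun x => complex.Re (g x)).
    by apply/funext => x; rewrite fctE raddfD.
  exact: measurable_funD.
- have -> : (fun x => complex.Im ((f + g) x)) =
      (fun x => complex.Im (f x)) \+ (fun x => complex.Im (g x)).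
    by apply/funext => x; rewrite fctE raddfD.
  exact: measurable_funD.
Qed.

Lemma cmeasurable_funN (f : R -> R[i]) :
  cmeasurable_fun period f -> cmeasurable_fun period (- f).
Proof.
move=> [f1 f2]; split.
- have -> : (fun x => complex.Re ((- f) x)) = \- (fun x => complex.Re (f x)).
    by apply/funext => x; rewrite fctE raddfN.
  exact: measurable_funN.
- have -> : (fun x => complex.Im ((- f) x)) = \- (fun x => complex.Im (f x)).
    by apply/funext => x; rewrite fctE raddfN.
  exact: measurable_funN.
Qed.

Lemma ccontinuous_measurable (f : R -> R[i]) : ccontinuous f -> cmeasurable_fun period f.
Proof.
by move=> [c1 c2]; split; apply: measurable_funTS; apply: continuous_measurable_fun.
Qed.

Section Weight.
Variable mu : R -> R.
Hypothesis mmu : measurable_fun (@period R) mu.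
Hypothesis mu_ge0 : forall x, period x -> 0 <= mu x.

Lemma measurable_weighted (f : R -> R[i]) : cmeasurable_fun period f ->
  measurable_fun period (fun x => (normc (f x) * mu x)%:E).
Proof.
by move=> mf; apply/measurable_EFinP; apply: measurable_funM => //; exact: cmeasurable_normc.
Qed.

Lemma weighted_ge0 (f : R -> R[i]) x : period x -> (0 <= (normc (f x) * mu x)%:E)%E.
Proof. by move=> px; rewrite lee_fin mulr_ge0 ?normc_ge0 // mu_ge0. Qed.

Lemma L1w_norm_ge0 (f : R -> R[i]) : (0 <= L1w_norm mu f)%E.
Proof. by apply: integral_ge0 => x px; exact: weighted_ge0. Qed.

Lemma L1w_normD (f g : R -> R[i]) : cmeasurable_fun period f -> cmeasurable_fun period g ->
  (L1w_norm mu (f + g)%R <= L1w_norm mu f + L1w_norm mu g)%E.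
Proof.
move=> mf mg; rewrite /L1w_norm -ge0_integralD //; first last.
- exact: measurable_weighted.
- exact: weighted_ge0.
- exact: measurable_weighted.
- exact: weighted_ge0.
- exact: measurable_period.
apply: ge0_le_integral => //.
- exact: measurable_period.
- exact: weighted_ge0.
- by apply: measurable_weighted; exact: cmeasurable_funD.
- by apply: emeasurable_funD; exact: measurable_weighted.
- move=> x px; rewrite -EFinD lee_fin -mulrDl ler_wpM2r ?mu_ge0 //.
  exact: le_normcD.
Qed.

Lemma L1w_normN (f : R -> R[i]) : L1w_norm mu (- f) = L1w_norm mu f.
Proof. by apply: eq_integral => x _; rewrite fctE normcN. Qed.

Lemma L1w_norm_le1 (f : R -> R[i]) : (forall x, period x -> mu x <= 1) ->
  cmeasurable_fun period f -> (L1w_norm mu f <= L1w_norm (fun _ => 1%R) f)%E.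
Proof.
move=> mu1 mf; apply: ge0_le_integral => //.
- exact: measurable_period.
- exact: weighted_ge0.
- exact: measurable_weighted.
- apply/measurable_EFinP; apply: measurable_funM => //; exact: cmeasurable_normc.
- by move=> x px; rewrite lee_fin ler_wpM2l ?normc_ge0 // mu1.
Qed.

End Weight.

End TrigSums.

(** * Riesz products *)

Section Riesz.
Context {R : realType}.
Variables (a : R) (n0 : nat).
Hypothesis n0_gt0 : (0 < n0)%N.

Definition riesz_freq (k : nat) : nat := (n0 * 3 ^ k)%N.

Definition shift_terms (h : int) (s : seq (int * R[i])) : seq (int * R[i]) :=
  [seq (p.1 + h, (a / 2)%:C%C * p.2) | p <- s].

Definition side_terms (h : int) s := shift_terms h s ++ shift_terms (- h) s.

(** The expansion of the product, listed in the order in which the factors are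
    multiplied out: each factor adds two translates of all the earlier terms.
    Partial sums are taken in this order. *)
Fixpoint riesz_terms (N : nat) : seq (int * R[i]) :=
  if N is k.+1 then riesz_terms k ++ side_terms (riesz_freq k) (riesz_terms k)
  else [:: (0, 1)].

Definition riesz_prod (N : nat) (x : R) : R :=
  \prod_(k < N) (1 + a * cos ((riesz_freq k)%:~R * x)).

Lemma riesz_prodS k x :
  riesz_prod k.+1 x = riesz_prod k x * (1 + a * cos ((riesz_freq k)%:~R * x)).
Proof. by rewrite /riesz_prod big_ord_recr. Qed.

Lemma riesz_prod0 x : riesz_prod 0 x = 1.
Proof. by rewrite /riesz_prod big_ord0. Qed.

Lemma trig_sum_shift h s x :
  trig_sum (shift_terms h s) x = (a / 2)%:C%C * cis (h%:~R * x) * trig_sum s x.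
Proof.
rewrite /trig_sum big_map mulr_sumr; apply: eq_bigr => p _ /=.
by rewrite rmorphD /= mulrDl cisD; ring.
Qed.

Lemma trig_sum_side h s x :
  trig_sum (side_terms h s) x = (a * cos (h%:~R * x))%:C%C * trig_sum s x.
Proof.
rewrite trig_sum_cat !trig_sum_shift -mulrDl -mulrDr rmorphN /= mulNr cis_conj -rmorphM /=.
by congr (_%:C%C * _); field.
Qed.

Lemma trig_sum_riesz N x : trig_sum (riesz_terms N) x = (riesz_prod N x)%:C%C.
Proof.
elim: N => [|k IH].
  by rewrite riesz_prod0 /= trig_sum_cons trig_sum_nil mul0r /cis cos0 sin0 mul1r addr0.
rewrite /= trig_sum_cat trig_sum_side IH riesz_prodS mulrDr mulr1 rmorphD /= -rmorphM /=.
by congr (_ + _%:C%C); rewrite mulrC.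
Qed.

Lemma riesz_freq_gt0 k : (0 < riesz_freq k)%N.
Proof. by rewrite /riesz_freq muln_gt0 n0_gt0 expn_gt0. Qed.

Lemma riesz_freqS k : riesz_freq k.+1 = (riesz_freq k * 3)%N.
Proof. by rewrite /riesz_freq expnSr mulnA. Qed.

Lemma mem_side_terms h s (p : int * R[i]) : p \in side_terms h s ->
  exists2 q : int * R[i], q \in s & (p.1 = q.1 + h \/ p.1 = q.1 - h) /\ p.2 = (a / 2)%:C%C * q.2.
Proof.
rewrite mem_cat => /orP[] /mapP[q qs ->]; exists q => //; split=> //; by [left|right].
Qed.

(** Each factor multiplies the bound [n_k / 2] of the spectrum by 3, since
    [n_k / 2 + n_k = n_(k+1) / 2]. The translates by [n_k] and [- n_k] thus
    meet neither the earlier spectrum nor each other. *)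
Lemma riesz_terms_lt N (p : int * R[i]) : p \in riesz_terms N -> (2 * `|p.1| < riesz_freq N)%N.
Proof.
elim: N p => [|k IH] p /=.
  by rewrite inE => /eqP -> /=; rewrite muln0 riesz_freq_gt0.
have := riesz_freq_gt0 k; rewrite mem_cat riesz_freqS.
move=> n0' /orP[/IH|/mem_side_terms[q /IH + [+ _]]]; lia.
Qed.

Lemma uniq_riesz_terms N : uniq [seq p.1 | p <- riesz_terms N].
Proof.
elim: N => [//|k IH] /=; have np := riesz_freq_gt0 k.
have fr j : j \in [seq p.1 | p <- riesz_terms k] -> (2 * `|j| < riesz_freq k)%N.
  by move=> /mapP[p /riesz_terms_lt ? ->].
have E h : [seq p.1 | p <- shift_terms h (riesz_terms k)] =
    [seq j + h | j <- [seq p.1 | p <- riesz_terms k]].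
  by rewrite -!map_comp.
have U h : uniq [seq j + h | j <- [seq p.1 | p <- riesz_terms k]].
  by rewrite (map_inj_uniq (@addIr _ h)).
rewrite !map_cat !E !cat_uniq IH !U !andbT /=.
apply/andP; split; apply/hasPn => j.
  by rewrite mem_cat => /orP[] /mapP[i /fr ? ->]; apply/negP => /fr; lia.
by move=> /mapP[i /fr ? ->]; apply/negP => /mapP[i' /fr ? ?]; lia.
Qed.

Definition riesz_tail N := behead (riesz_terms N).

Lemma riesz_terms_head N : riesz_terms N = (0, 1) :: riesz_tail N.
Proof. by elim: N => [//|k IH]; rewrite /riesz_tail /= {1 3}IH. Qed.

Lemma riesz_tailS k :
  riesz_tail k.+1 = riesz_tail k ++ side_terms (riesz_freq k) (riesz_terms k).
Proof. by rewrite /riesz_tail /= {1}riesz_terms_head. Qed.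

Lemma uniq_riesz_tail N : uniq [seq p.1 | p <- riesz_tail N].
Proof. by have := uniq_riesz_terms N; rewrite riesz_terms_head /= => /andP[]. Qed.

Lemma riesz_tail_ge N (p : int * R[i]) : p \in riesz_tail N -> (n0 <= 2 * `|p.1|)%N.
Proof.
elim: N p => [//|k IH] p; rewrite riesz_tailS mem_cat => /orP[/IH //|].
move=> /mem_side_terms[q /riesz_terms_lt + [+ _]].
have : (n0 <= riesz_freq k)%N by rewrite /riesz_freq leq_pmulr // expn_gt0.
lia.
Qed.

Lemma trig_sum_riesz_tail N x : trig_sum (riesz_tail N) x = (riesz_prod N x - 1)%:C%C.
Proof.
have := trig_sum_riesz N x; rewrite riesz_terms_head trig_sum_cons /= mul0r.
rewrite /cis cos0 sin0 mul1r rmorphB /= => <-.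
by rewrite addrC addKr.
Qed.

(** The sum over the factors of [u - u^2 / 4] with [u = a * cos (n_k x)], without
    its constant term [- N * a^2 / 8]. *)
Definition riesz_log (N : nat) (x : R) : R :=
  \sum_(k < N) (a * cos ((riesz_freq k)%:~R * x)
                - a ^+ 2 / 8 * cos ((2 * riesz_freq k)%N%:~R * x)).

Fixpoint riesz_log_terms (N : nat) : seq (int * R[i]) :=
  if N is k.+1 then riesz_log_terms k ++
    [:: ((riesz_freq k)%:Z, (a / 2)%:C%C); (- (riesz_freq k)%:Z, (a / 2)%:C%C);
        ((2 * riesz_freq k)%N%:Z, (- (a ^+ 2 / 16))%:C%C);
        (- (2 * riesz_freq k)%N%:Z, (- (a ^+ 2 / 16))%:C%C)]
  else [::].

Lemma trig_sum_riesz_log N x : trig_sum (riesz_log_terms N) x = (riesz_log N x)%:C%C.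
Proof.
rewrite /riesz_log; elim: N => [|k IH]; first by rewrite big_ord0 trig_sum_nil.
rewrite big_ord_recr /= trig_sum_cat IH !trig_sum_cons trig_sum_nil addr0 /=.
set F := \sum_(i < k) _; set t1 := (riesz_freq k)%:~R * x; set t2 := (2 * riesz_freq k)%N%:~R * x.
rewrite !mulrNz !mulNr -/t1 -/t2 [X in _ + X]addrA -!mulrDr !cis_conj.
have CD (u v : R) : u%:C%C + v%:C%C = (u + v)%:C%C :> R[i] by rewrite rmorphD.
have CM (u v : R) : u%:C%C * v%:C%C = (u * v)%:C%C :> R[i] by rewrite rmorphM.
rewrite !CM !CD.
by congr _%:C%C; field.
Qed.

Lemma riesz_log_terms_lt N (p : int * R[i]) :
  p \in riesz_log_terms N -> (`|p.1| < riesz_freq N)%N.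
Proof.
elim: N p => [//|k IH] p /=; have := riesz_freq_gt0 k.
rewrite mem_cat riesz_freqS => n0' /orP[/IH|]; first lia.
by rewrite !inE => /or4P[] /eqP -> /=; lia.
Qed.

Lemma uniq_riesz_log_terms N : uniq [seq p.1 | p <- riesz_log_terms N].
Proof.
elim: N => [//|k IH] /=; have n0' := riesz_freq_gt0 k.
rewrite map_cat cat_uniq IH /=; apply/andP; split.
  apply/norP; split.
    by apply/mapP => -[p /riesz_log_terms_lt /= ? ?]; lia.
  apply/norP; split.
    by apply/mapP => -[p /riesz_log_terms_lt /= ? ?]; lia.
  apply/norP; split.
    by apply/mapP => -[p /riesz_log_terms_lt /= ? ?]; lia.
  rewrite orbF; by apply/mapP => -[p /riesz_log_terms_lt /= ? ?]; lia.
rewrite !inE; lia.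
Qed.

Hypotheses (a_ge0 : 0 <= a) (a_le1 : a <= 2^-1).

Lemma normc_half : normc (a / 2)%:C%C = a / 2.
Proof. by rewrite normc_real ger0_norm // divr_ge0. Qed.

Lemma riesz_coef_le1 N p : p \in riesz_terms N -> normc p.2 <= 1.
Proof.
elim: N p => [|k IH] p /=; first by rewrite inE => /eqP ->; rewrite normc1.
rewrite mem_cat => /orP[/IH //|/mem_side_terms[q /IH q1 [_ ->]]].
rewrite normcM normc_half mulr_ile1 ?normc_ge0 ?divr_ge0 //.
by rewrite ler_pdivrMr // mul1r; have := a_le1; lra.
Qed.

Lemma riesz_tail_coef N p : p \in riesz_tail N -> normc p.2 <= a.
Proof.
elim: N p => [//|k IH] p; rewrite riesz_tailS mem_cat => /orP[/IH //|].
move=> /mem_side_terms[q /riesz_coef_le1 q1 [_ ->]]; rewrite normcM normc_half.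
apply: le_trans (_ : a / 2 * 1 <= _); last by have := a_ge0; lra.
by rewrite ler_wpM2l ?divr_ge0.
Qed.

Definition sqr_sum (s : seq (int * R[i])) := \sum_(p <- s) normc p.2 ^+ 2.

Lemma sqr_sum_cat s t : sqr_sum (s ++ t) = sqr_sum s + sqr_sum t.
Proof. by rewrite /sqr_sum big_cat. Qed.

Lemma sqr_sum_ge0 s : 0 <= sqr_sum s.
Proof. by apply: sumr_ge0 => p _; exact: sqr_ge0. Qed.

Lemma sqr_sum_side h s : sqr_sum (side_terms h s) = a ^+ 2 / 2 * sqr_sum s.
Proof.
have E k : sqr_sum (shift_terms k s) = (a / 2) ^+ 2 * sqr_sum s.
  rewrite /sqr_sum big_map mulr_sumr; apply: eq_bigr => p _ /=.
  by rewrite normcM normc_half exprMn.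
by rewrite sqr_sum_cat !E -mulrDl; congr (_ * _); field.
Qed.

Lemma sqr_sum_riesz N : sqr_sum (riesz_terms N) = (1 + a ^+ 2 / 2) ^+ N.
Proof.
elim: N => [|k IH]; first by rewrite /sqr_sum big_seq1 normc1 expr1n expr0.
by rewrite /= sqr_sum_cat sqr_sum_side IH [RHS]exprS mulrDl mul1r.
Qed.

Lemma riesz_factor_gt0 k x : 0 < 1 + a * cos ((riesz_freq k)%:~R * x).
Proof.
have : `|a * cos ((riesz_freq k)%:~R * x)| <= 2^-1.
  rewrite normrM (ger0_norm a_ge0) -[2^-1]mulr1; apply: ler_pM => //.
  by rewrite ler_norml cos_geN1 cos_le1.
rewrite ler_norml => /andP[+ _]; have := a_le1; lra.
Qed.

Lemma riesz_prod_ge0 N x : 0 <= riesz_prod N x.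
Proof. by apply: prodr_ge0 => k _; exact/ltW/riesz_factor_gt0. Qed.

Lemma continuous_riesz_prod N : continuous (riesz_prod N).
Proof.
have -> : riesz_prod N = fun x => complex.Re (trig_sum (riesz_terms N) x).
  by apply/funext => x; rewrite trig_sum_riesz.
exact: (ccontinuous_trig_sum _).1.
Qed.

Lemma pint_riesz_prod N : pint (riesz_prod N) = 2 * pi.
Proof.
have -> : riesz_prod N = fun x => complex.Re (trig_sum (riesz_tail N) x) + 1.
  by apply/funext => x; rewrite trig_sum_riesz_tail /= subrK.
rewrite pintD; last by move=> x; exact: cvg_cst.
  rewrite pint_cst mulr1 pint_Re_trig_sum ?add0r //.
  have := uniq_riesz_terms N; rewrite riesz_terms_head /= => /andP[+ _].
  by [].
exact: (ccontinuous_trig_sum _).1.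
Qed.

Lemma uniq_side_terms k :
  uniq [seq p.1 | p <- side_terms (riesz_freq k) (riesz_terms k)].
Proof.
by have := uniq_riesz_terms k.+1; rewrite /= map_cat cat_uniq => /and3P[].
Qed.

Lemma L1_riesz_tail N : (L1w_norm (fun _ => 1%R) (trig_sum (riesz_tail N)) <= (4 * pi)%:E)%E.
Proof.
have cP : continuous (riesz_prod N) by exact: continuous_riesz_prod.
apply: (@le_trans _ _ (\int[lebesgue_measure]_(x in period) (riesz_prod N x + 1)%:E)%E).
  apply: ge0_le_integral => //.
  - exact: measurable_period.
  - by move=> x _; rewrite lee_fin mulr1 normc_ge0.
  - apply: measurable_weighted; first exact: measurable_cst.
    exact/ccontinuous_measurable/ccontinuous_trig_sum.
  - apply/measurable_EFinP/measurable_funTS; apply: continuous_measurable_fun.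
    by move=> x; apply: cvgD; [exact: cP|exact: cvg_cst].
  - move=> x _; rewrite lee_fin mulr1 trig_sum_riesz_tail normc_real.
    by rewrite (le_trans (ler_normB _ _)) // normr1 ger0_norm // riesz_prod_ge0.
rewrite integral_pint; last by move=> x; apply: cvgD; [exact: cP|exact: cvg_cst].
rewrite pintD //; last by move=> x; exact: cvg_cst.
rewrite pint_riesz_prod pint_cst lee_fin; lra.
Qed.

(** Between two consecutive products the partial sums only add terms of one
    new frequency band, and these have a mean square of at most 1. *)
Lemma L1_riesz_tail_prefix N m : a ^+ 2 / 2 * (1 + a ^+ 2 / 2) ^+ N <= 1 ->
  (L1w_norm (fun _ => 1%R) (trig_sum (take m (riesz_tail N))) <= (6 * pi)%:E)%E.
Proof.
have a2 : 0 <= a ^+ 2 / 2 by rewrite divr_ge0 // sqr_ge0.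
elim: N m => [|k IH] m small.
  rewrite /riesz_tail /= trig_sum_nil /L1w_norm.
  under eq_integral do rewrite normc0 mul0r.
  by rewrite integral0 lee_fin mulr_ge0 // pi_ge0.
have small' : a ^+ 2 / 2 * (1 + a ^+ 2 / 2) ^+ k <= 1.
  apply: le_trans small; rewrite [_ ^+ k.+1]exprS ler_wpM2l // ler_peMl //.
  - by rewrite exprn_ge0 // addr_ge0.
  - by rewrite lerDl.
rewrite riesz_tailS take_cat; case: ifP => _; first exact: IH.
set t := take _ _.
have -> : trig_sum (riesz_tail k ++ t) = trig_sum (riesz_tail k) + trig_sum t.
  by apply/funext => x; rewrite trig_sum_cat.
have mt s : cmeasurable_fun (@period R) (trig_sum s).
  exact/ccontinuous_measurable/ccontinuous_trig_sum.
apply: le_trans (L1w_normD _ _ _ _) _ => //.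
have -> : (6 * pi)%:E = (4 * pi)%:E + (2 * pi * 1)%:E :> \bar R.
  by rewrite -EFinD; congr EFin; ring.
apply: leeD; first exact: L1_riesz_tail.
have st : subseq t (side_terms (riesz_freq k) (riesz_terms k)) by exact: take_subseq.
apply: pint_normc_le => //.
  exact: subseq_uniq (map_subseq _ st) (uniq_side_terms k).
rewrite expr1n; apply: le_trans small'; rewrite -sqr_sum_riesz -(sqr_sum_side (riesz_freq k)).
rewrite /sqr_sum; set w := side_terms _ _.
rewrite -[in leRHS](cat_take_drop (m - size (riesz_tail k)) w) big_cat /= -/t lerDl.
exact: sqr_sum_ge0.
Qed.

Lemma sqr_sum_riesz_log N : sqr_sum (riesz_log_terms N) <= a ^+ 2 * N%:R.
Proof.
have a2 := a_ge0; have a1 := a_le1.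
elim: N => [|k IH]; first by rewrite /sqr_sum big_nil mulr0.
have -> : a ^+ 2 * k.+1%:R = a ^+ 2 * k%:R + a ^+ 2 by rewrite mulrSr mulrDr mulr1.
rewrite [riesz_log_terms _]/= sqr_sum_cat lerD //.
rewrite /sqr_sum !big_cons big_nil addr0 ![snd _]/= !normc_real !real_normK ?num_real //.
have : a ^+ 2 <= 1 by nra.
have := sqr_ge0 a; set b := a ^+ 2; move=> b0 b1.
have -> : (a / 2) ^+ 2 = b / 4 by rewrite /b; field.
nra.
Qed.

(** The exponent leaves room at second order, so it is enough to raise
    [1 + y <= expR y] to the fourth power, at a quarter of the exponent. *)
Lemma one_add_le_exp (u : R) : `|u| <= 2^-1 -> 1 + u <= expR (u - u ^+ 2 / 4).
Proof.
rewrite ler_norml => /andP[u1 u2].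
pose y := (u - u ^+ 2 / 4) / 4.
have y1 : 0 <= 1 + y by rewrite /y; nra.
have -> : u - u ^+ 2 / 4 = y *+ 4 by rewrite -mulr_natr /y; field.
rewrite -mulr_natl expRM_natl.
apply: (@le_trans _ _ ((1 + y) ^+ 4)); last by rewrite lerXn2r ?nnegrE ?expR_ge0 ?expR_ge1Dx.
(* [c] is chosen so that [(1 + y) ^+ 2 = 1 + u * c]. *)
pose c := 2^-1 - u / 16 - u ^+ 2 / 32 + u ^+ 3 / 256.
have u3 : u ^+ 2 <= 4^-1 by nra.
have c1 : 2 / 5 <= c.
  suff : 0 <= u ^+ 3 + 8^-1 by rewrite /c; lra.
  have -> : u ^+ 3 + 8^-1 = (u + 2^-1) * ((u - 4^-1) ^+ 2 + 3 / 16) by field.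
  by apply: mulr_ge0; [lra|apply: addr_ge0; [exact: sqr_ge0|lra]].
have c2 : 4 / 25 <= c ^+ 2.
  have -> : 4 / 25 = (2 / 5) ^+ 2 :> R by field.
  by rewrite lerXn2r ?nnegrE //; lra.
have -> : (1 + y) ^+ 4 = 1 + u + u ^+ 2 * (c ^+ 2 - 8^-1 - u / 16 + u ^+ 2 / 128).
  by rewrite /y /c; field.
rewrite lerDl mulr_ge0 ?sqr_ge0 //.
suff : 0 <= u ^+ 2 by lra.
exact: sqr_ge0.
Qed.

Lemma continuous_riesz_log N : continuous (riesz_log N).
Proof.
have -> : riesz_log N = fun x => complex.Re (trig_sum (riesz_log_terms N) x).
  by apply/funext => x; rewrite trig_sum_riesz_log.
exact: (ccontinuous_trig_sum _).1.
Qed.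

Lemma measurable_superlevel (f : R -> R) (t : R) : continuous f ->
  measurable (period `&` [set x | t < f x]).
Proof.
move=> cf; rewrite -preimage_itvoy.
by apply: measurable_funTS => //; [exact: continuous_measurable_fun|exact: measurable_period].
Qed.

Lemma riesz_prod_le_exp N x :
  riesz_prod N x <= expR (riesz_log N x - a ^+ 2 * N%:R / 8).
Proof.
rewrite /riesz_log; elim: N => [|k IH].
  by rewrite riesz_prod0 big_ord0 mulr0 mul0r subrr expR0.
rewrite riesz_prodS big_ord_recr /=.
set F := \sum_(i < k) _ in IH *; set th := (riesz_freq k)%:~R * x.
have -> : F + (a * cos th - a ^+ 2 / 8 * cos ((2 * riesz_freq k)%N%:~R * x)) -
    a ^+ 2 * k.+1%:R / 8 = (F - a ^+ 2 * k%:R / 8) + (a * cos th - (a * cos th) ^+ 2 / 4).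
  have -> : (2 * riesz_freq k)%N%:~R * x = th *+ 2.
    by rewrite PoszM rmorphM /= -mulrA -/th mulr_natl.
  by rewrite cos_mulr2n -natr1; field.
rewrite expRD; apply: ler_pM => //.
- exact: riesz_prod_ge0.
- exact/ltW/riesz_factor_gt0.
- apply: one_add_le_exp.
  rewrite normrM (ger0_norm a_ge0) -[2^-1]mulr1; apply: ler_pM => //.
  by rewrite ler_norml cos_geN1 cos_le1.
Qed.

Lemma measurable_trig_sum s : cmeasurable_fun (@period R) (trig_sum s).
Proof. exact/ccontinuous_measurable/ccontinuous_trig_sum. Qed.

(** Chebyshev's inequality: [riesz_log] has a mean square of at most [S], by
    Parseval, while exceeding the bound forces it above [S / 16]. *)
Lemma riesz_prod_large (S : R) (N : nat) : 0 < S -> a ^+ 2 * N%:R = S ->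
  (lebesgue_measure (period `&` [set x | (expR (- (S / 16)) < riesz_prod N x)%R])
   <= (2 * 16 ^+ 2 * pi / S)%:E)%E.
Proof.
move=> S0 aN.
have cF : continuous (riesz_log N) by exact: continuous_riesz_log.
have cF2 : continuous (fun x => riesz_log N x ^+ 2).
  by move=> x; under eq_fun do rewrite expr2; apply: cvgM; exact: cF.
pose A : set R := period `&` [set x | S / 16 < riesz_log N x].
have mA : measurable A by exact: measurable_superlevel.
have PA : period `&` [set x | expR (- (S / 16)) < riesz_prod N x] `<=` A.
  move=> x [px /= /lt_le_trans/(_ (riesz_prod_le_exp N x))].
  by rewrite ltr_expR aN => ?; split=> //=; lra.
apply: (@le_trans _ _ (lebesgue_measure A)).
  apply: le_measure => //; rewrite inE //.
  by apply: measurable_superlevel; exact: continuous_riesz_prod.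
have F2 : (\int[lebesgue_measure]_(x in A) ((S / 16) ^+ 2)%:E <= (2 * pi * S)%:E)%E.
  apply: (@le_trans _ _ (\int[lebesgue_measure]_(x in period) (riesz_log N x ^+ 2)%:E)%E).
    apply: (@le_trans _ _ (\int[lebesgue_measure]_(x in A) (riesz_log N x ^+ 2)%:E)%E).
      apply: ge0_le_integral => //.
      - by move=> x _; rewrite lee_fin sqr_ge0.
      - by apply/measurable_EFinP/measurable_funTS; exact: continuous_measurable_fun.
      - move=> x [_ /= Fx]; rewrite lee_fin lerXn2r ?nnegrE ?divr_ge0 ?(ltW S0) //.
          by apply: le_trans (ltW Fx); rewrite divr_ge0 ?(ltW S0).
        exact: ltW.
    apply: ge0_subset_integral => //.
    - exact: measurable_period.
    - by apply/measurable_EFinP/measurable_funTS; exact: continuous_measurable_fun.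
    - by move=> x _; rewrite lee_fin sqr_ge0.
    - by move=> x [].
  rewrite integral_pint // lee_fin.
  have -> : (fun x => riesz_log N x ^+ 2) =
      (fun x => normc (trig_sum (riesz_log_terms N) x) ^+ 2).
    by apply/funext => x; rewrite trig_sum_riesz_log normc_real real_normK ?num_real.
  rewrite parseval ?uniq_riesz_log_terms // ler_wpM2l ?(ltW period_lt) //.
  by rewrite -aN; exact: sqr_sum_riesz_log.
move: F2; rewrite integral_cst //.
have S2 : 0 < (S / 16) ^+ 2 by rewrite exprn_gt0 // divr_gt0.
have -> : ((2 * 16 ^+ 2 * pi / S)%:E = (((S / 16) ^+ 2)^-1)%:E * (2 * pi * S)%:E)%E.
  by rewrite -EFinM; congr EFin; field; rewrite gt_eqF.
by rewrite lee_pdivlMl.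
Qed.

End Riesz.

(** * Blocks *)

Section Blocks.
Context {R : realType}.

Lemma exists_nat_ge (x : R) : exists n : nat, x <= n%:R.
Proof.
by exists (Num.truncn x).+1; apply: ltW; exact: truncnS_gt.
Qed.

Lemma le_exp_invr (x : R) : 0 < x -> expR (- x) <= x^-1.
Proof.
move=> x0; rewrite expRN lef_pV2 ?posrE ?expR_gt0 //.
by apply: le_trans (expR_ge1Dx x); rewrite lerDr.
Qed.

(** [S], hence the bound [Sig] of the sum of squares, depends on the admissible
    exceptional set only. Afterwards [a] can still be taken as small as desired,
    at the price of more factors. *)
Lemma riesz_block (d : R) : 0 < d -> exists2 Sig : R, 0 < Sig &
  forall (eta : R) (D : nat), 0 < eta ->
  exists (s : seq (int * R[i])) (P : R -> R),
  [/\ uniq [seq p.1 | p <- s],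
      (forall p : int * R[i], p \in s -> (D < `|p.1|)%N /\ normc p.2 <= eta),
      \sum_(p <- s) normc p.2 ^+ 2 <= Sig &
      forall m, (L1w_norm (fun _ => 1%R) (trig_sum (take m s)) <= (6 * pi)%:E)%E] /\
  [/\ continuous P, forall x, 0 <= P x,
      forall x, trig_sum s x = (P x - 1)%:C%C &
      (lebesgue_measure (period `&` [set x | (d < P x)%R]) <= d%:E)%E].
Proof.
move=> d0.
have [A [A0 A16 Api]] : exists A : R, [/\ 0 < A, 16 <= A & 2 * 16 ^+ 2 * pi <= A].
  exists (16 + 2 * 16 ^+ 2 * pi); have := @pi_gt0 R; split; lra.
have [S dS] := exists_nat_ge (A / d).
have S0 : 0 < S%:R :> R by apply: lt_le_trans dS; rewrite divr_gt0.
have dS' : A / S%:R <= d by rewrite ler_pdivrMr // mulrC -ler_pdivrMr.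
exists (expR S%:R); first exact: expR_gt0.
move=> eta D eta0.
have [m0 hm] := exists_nat_ge (2 + eta^-1 + expR S%:R).
have m2 : 0 < m0%:R :> R.
  by apply: lt_le_trans hm; rewrite !addr_gt0 ?invr_gt0 ?expR_gt0.
have e0 := expR_gt0 (S%:R : R); have ei : 0 < eta^-1 by rewrite invr_gt0.
pose a : R := m0%:R^-1.
have a0 : 0 < a by rewrite invr_gt0.
have a_ge0 := ltW a0.
have a1 : a <= 2^-1 by rewrite lef_pV2 ?posrE //; lra.
have aeta : a <= eta by rewrite -[eta]invrK lef_pV2 ?posrE //; lra.
have aS : a * expR S%:R <= 1 by rewrite mulrC ler_pdivrMr // mul1r; lra.
pose N := (S * m0 ^ 2)%N.
have aN : a ^+ 2 * N%:R = S%:R.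
  by rewrite /N natrM natrX /a; field; rewrite gt_eqF.
have n0 : (0 < 2 * D + 1)%N by rewrite addn1.
have expN : (1 + a ^+ 2 / 2) ^+ N <= expR S%:R.
  have aS2 : expR (a ^+ 2 / 2) ^+ N <= expR S%:R.
    rewrite -expRM_natl ler_expR.
    have -> : N%:R * (a ^+ 2 / 2) = S%:R / 2 by rewrite -aN; field.
    lra.
  apply: le_trans aS2; rewrite lerXn2r ?nnegrE ?expR_ge0 ?expR_ge1Dx //.
  by rewrite addr_ge0 // divr_ge0 // sqr_ge0.
have small : a ^+ 2 / 2 * (1 + a ^+ 2 / 2) ^+ N <= 1.
  apply: le_trans aS; apply: ler_pM => //.
  - by rewrite divr_ge0 // sqr_ge0.
  - by rewrite exprn_ge0 // addr_ge0 // divr_ge0 // sqr_ge0.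
  - by nra.
exists (riesz_tail a (2 * D + 1) N), (riesz_prod a (2 * D + 1) N); split; split.
- exact: uniq_riesz_tail.
- move=> p ps; split; first by move: (riesz_tail_ge n0 ps); clear; lia.
  by apply: le_trans aeta; exact: riesz_tail_coef ps.
- apply: le_trans expN; rewrite -(@sqr_sum_riesz _ a (2 * D + 1) a_ge0 N).
  by rewrite /sqr_sum riesz_terms_head big_cons lerDr sqr_ge0.
- by move=> m; exact: L1_riesz_tail_prefix.
- exact: continuous_riesz_prod.
- by move=> x; exact: riesz_prod_ge0.
- by move=> x; exact: trig_sum_riesz_tail.
- have := riesz_prod_large n0 a_ge0 a1 S0 aN.
  have iS0 : 0 <= S%:R^-1 :> R by rewrite invr_ge0 ltW.
  have h1 : 2 * 16 ^+ 2 * pi / S%:R <= d.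
    apply: (le_trans _ dS').
    exact: (ler_wpM2r iS0 Api).
  move/le_trans => /(_ d%:E); rewrite lee_fin => /(_ h1); apply: le_trans.
  have cP : continuous (riesz_prod a (2 * D + 1) N) by exact: continuous_riesz_prod.
  apply: le_measure; rewrite ?inE; try exact: measurable_superlevel.
  move=> x [px /= dP]; split=> //=; apply: le_lt_trans dP.
  apply: le_trans dS'; apply: le_trans (le_exp_invr _) _; first by rewrite divr_gt0.
  by rewrite invf_div ler_pM2r ?invr_gt0.
Qed.

(** The part [1 / (n + 1)] of the exponent in excess of 2 turns the bound
    [x <= K^-(n+1)] into a gain [1 / K]. *)
Lemma powR_le_small (x q K : R) (n : nat) : 0 <= x -> 0 < K ->
  2 + n.+1%:R^-1 <= q -> x * K ^+ n.+1 <= 1 -> x <= 1 -> x `^ q <= x ^+ 2 / K.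
Proof.
move=> x0 K0 qn xK x1.
have n0 : 0 < n.+1%:R^-1 :> R by rewrite invr_gt0.
have [->|x0'] := eqVneq x 0.
  by rewrite powR0 ?expr0n ?mul0r // gt_eqF // (lt_le_trans _ qn) // addr_gt0.
have xp : 0 < x by rewrite lt_def x0' x0.
apply: (@le_trans _ _ (x `^ (2 + n.+1%:R^-1))).
  by apply: ger_powR => //; rewrite xp.
rewrite powRD; last by rewrite x0' implybT.
rewrite -(powR_mulrn 2) // ler_wpM2l ?powR_ge0 //.
have -> : K^-1 = ((K^-1) ^+ n.+1) `^ n.+1%:R^-1.
  rewrite -powR_mulrn ?invr_ge0 ?(ltW K0) // -powRrM mulfV ?pnatr_eq0 //.
  by rewrite powRr1 // invr_ge0 ltW.
apply: ge0_ler_powR; rewrite ?nnegrE ?(ltW n0) //.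
  by rewrite exprn_ge0 // invr_ge0 ltW.
by rewrite exprVn -ler_pdivlMr ?exprn_gt0 // div1r in xK *.
Qed.

(** The quality demanded of the [n]-th block. The exponents [2 + 1 / (n + 1)]
    decrease to 2, so each [q > 2] is covered by all blocks but finitely many.
    The bound on the partial sums is for the weight 1, because the blocks are
    chosen before the weight. *)
Definition is_block (n D : nat) (l : int) (c : R[i]) (s : seq (int * R[i])) (e : R -> R) :=
  [/\ uniq [seq p.1 | p <- s],
      (forall p : int * R[i], p \in s -> (D < `|p.1|)%N),
      (forall q : R, 2 + n.+1%:R^-1 <= q ->
         \sum_(p <- s) normc p.2 `^ q <= 2^-1 ^+ n) &
      forall m, (L1w_norm (fun _ => 1%R) (trig_sum (take m s)) <= (6 * pi * normc c)%:E)%E] /\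
  [/\ continuous e, forall x, 0 <= e x,
      forall x, normc (trig_sum s x - c * cis (l%:~R * x)) = e x &
      (lebesgue_measure (period `&` [set x | (2^-1 ^+ n < e x)%R]) <= (2^-1 ^+ n)%:E)%E].

Lemma block_exists (n D : nat) (l : int) (c : R[i]) : exists s e, is_block n D l c s e.
Proof.
have c0 := normc_ge0 c.
have t0 : 0 < 2^-1 ^+ n :> R by rewrite exprn_gt0.
pose d : R := 2^-1 ^+ n / (1 + normc c).
have d0 : 0 < d by rewrite divr_gt0 //; lra.
have dt : d <= 2^-1 ^+ n by rewrite ler_pdivrMr ?ler_peMr //; lra.
have [Sig S0 hS] := riesz_block d0.
pose S1 := normc c ^+ 2 * Sig + 1.
have S10 : 1 <= S1 by rewrite lerDr mulr_ge0 ?sqr_ge0 // ltW.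
(* The sum of squares of the block is below [S1], and [powR_le_small] gains the
   factor [1 / K], which leaves [2^-n]. *)
pose K := S1 / 2^-1 ^+ n.
have K1 : 1 <= K.
  rewrite ler_pdivlMr // mul1r; apply: le_trans S10.
  by apply: exprn_ile1; lra.
have K0 : 0 < K by apply: lt_le_trans K1.
have Kn : 1 <= K ^+ n.+1 by exact: exprn_ege1.
have Kn0 : 0 < K ^+ n.+1 by apply: lt_le_trans Kn.
pose eta := ((1 + normc c) * K ^+ n.+1)^-1.
have eta0 : 0 < eta by rewrite invr_gt0 mulr_gt0 //; lra.
have [s [P [[us s1 s2 s3] [cP P0 sP lP]]]] := hS eta (D + `|l|)%N eta0.
have ceta : normc c * eta * K ^+ n.+1 <= 1.
  rewrite /eta invfM mulrA -mulrA mulVf ?gt_eqF // mulr1 ler_pdivrMr ?mul1r //; lra.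
exists [seq (l + p.1, - c * p.2) | p <- s], (fun x => normc c * P x).
have tE (s' : seq (int * R[i])) x :
    trig_sum [seq (l + p.1, - c * p.2) | p <- s'] x = - (c * cis (l%:~R * x)) * trig_sum s' x.
  rewrite /trig_sum big_map mulr_sumr; apply: eq_bigr => p _ /=.
  by rewrite rmorphD /= mulrDl cisD; ring.
have coef (p : int * R[i]) : p \in [seq (l + p.1, - c * p.2) | p <- s] ->
    (D < `|p.1|)%N /\ normc p.2 * K ^+ n.+1 <= 1.
  move=> /mapP[p' /s1 [h1 h2] ->] /=; split; first by move: h1; clear; lia.
  rewrite normcM normcN; apply: le_trans ceta.
  by rewrite ler_wpM2r ?(ltW Kn0) // ler_wpM2l.
have coef1 (p : int * R[i]) : p \in [seq (l + p.1, - c * p.2) | p <- s] -> normc p.2 <= 1.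
  move=> /coef[_]; apply: le_trans; rewrite ler_peMr ?normc_ge0 //.
split; split.
- have -> : [seq p.1 | p <- [seq (l + p.1, - c * p.2) | p <- s]] =
      [seq l + j | j <- [seq p.1 | p <- s]] by rewrite -!map_comp.
  by rewrite (map_inj_uniq (@addrI _ l)).
- by move=> p /coef[].
- move=> q qn.
  apply: (@le_trans _ _ (\sum_(p <- [seq (l + p.1, - c * p.2) | p <- s]) normc p.2 ^+ 2 / K)).
    rewrite !big_seq; apply: ler_sum => p ps.
    apply: (powR_le_small (n := n)) => //; first exact: normc_ge0.
      exact: (coef p ps).2.
    exact: coef1.
  rewrite -mulr_suml ler_pdivrMr // mulrC /K divfK ?gt_eqF //.
  rewrite big_map; apply: (@le_trans _ _ (normc c ^+ 2 * Sig)); last by rewrite lerDl.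
  apply: (@le_trans _ _ (\sum_(p <- s) normc c ^+ 2 * normc p.2 ^+ 2)).
    by rewrite le_eqVlt; apply/orP; left; apply/eqP/eq_bigr => p _ /=;
      rewrite normcM normcN exprMn.
  by rewrite -mulr_sumr ler_wpM2l ?sqr_ge0.
- move=> m; rewrite -map_take; have := s3 m; set t := take m s.
  have -> : L1w_norm (fun=> 1) (trig_sum [seq (l + p.1, - c * p.2) | p <- t]) =
      ((normc c)%:E * L1w_norm (fun=> 1%R) (trig_sum t))%E.
    rewrite /L1w_norm -ge0_integralZl //.
    - by apply: eq_integral => x _; rewrite tE normcM normcN normcM normc_cis mulr1 -EFinM mulrA.
    - exact: measurable_period.
    - by apply: measurable_weighted; [exact: measurable_cst|exact: measurable_trig_sum].
    - by move=> x px; apply: weighted_ge0 px => y _; exact: ler01.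
  by move=> h; rewrite mulrC EFinM lee_wpmul2l.
- by move=> x; apply: cvgM; [exact: cvg_cst|exact: cP].
- by move=> x; rewrite mulr_ge0.
- move=> x; rewrite tE sP mulNr -opprD normcN -[X in _ + X]mulr1 -mulrDr rmorphB /= subrK.
  by rewrite !normcM normc_cis mulr1 normc_real ger0_norm.
- have cP' : continuous P by exact: cP.
  apply: (@le_trans _ _ (lebesgue_measure (period `&` [set x | (d < P x)%R]))); last first.
    by apply: le_trans lP _; rewrite lee_fin.
  have m1 : measurable (period `&` [set x | d < P x]) by exact: measurable_superlevel.
  have m2 : measurable (period `&` [set x | 2^-1 ^+ n < normc c * P x]).
    by apply: measurable_superlevel => x; apply: cvgM; [exact: cvg_cst|exact: cP].
  apply: le_measure; rewrite ?inE //.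
  move=> x [px /= h]; split=> //=; rewrite /d ltr_pdivrMr; last by lra.
  apply: lt_le_trans h _; rewrite mulrC ler_wpM2l //; lra.
Qed.

End Blocks.

(** * Density of trigonometric sums *)

Section TrigApproximation.
Context {R : realType}.
Variable mu : R -> R.
Hypotheses (mmu : measurable_fun (@period R) mu)
  (mu01 : forall x, period x -> 0 <= mu x <= 1).

Local Notation N := (L1w_norm mu).
Let mu_ge0 x : period x -> 0 <= mu x. Proof. by move=> /mu01/andP[]. Qed.

Definition trig_approx (f : R -> R[i]) := cmeasurable_fun period f /\
  forall d : R, 0 < d -> exists s, (N (f - trig_sum s)%R <= d%:E)%E.

Lemma L1w_norm0 : N 0 = 0%E.
Proof.
rewrite /L1w_norm; under eq_integral do rewrite normc0 mul0r.
by rewrite integral0.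
Qed.

Lemma trig_approx_trig s : trig_approx (trig_sum s).
Proof.
split; first exact: measurable_trig_sum.
by move=> d d0; exists s; rewrite subrr L1w_norm0 lee_fin ltW.
Qed.

Lemma trig_approxD f g : trig_approx f -> trig_approx g -> trig_approx (f + g).
Proof.
move=> [mf af] [mg ag]; split; first exact: cmeasurable_funD.
move=> d d0; have d2 : 0 < d / 2 by rewrite divr_gt0.
have [s hs] := af _ d2; have [t ht] := ag _ d2.
exists (s ++ t).
have -> : f + g - trig_sum (s ++ t) = (f - trig_sum s) + (g - trig_sum t).
  by apply/funext => x; rewrite !fctE trig_sum_cat opprD addrACA.
have mB h u : cmeasurable_fun (@period R) h -> cmeasurable_fun (@period R) (h - trig_sum u).
  by move=> mh; apply: cmeasurable_funD mh _; apply/cmeasurable_funN/measurable_trig_sum.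
apply: le_trans (L1w_normD _ _ _ _) _ => //; [exact: mB..|].
by rewrite [d]splitr EFinD leeD.
Qed.

Lemma trig_approx0 : trig_approx 0.
Proof. by rewrite -trig_sum_nil; exact: trig_approx_trig. Qed.

Lemma cmeasurable_scale (c : R[i]) f : cmeasurable_fun period f ->
  cmeasurable_fun period (fun x : R => c * f x).
Proof.
move=> [f1 f2]; case: c => a b; split.
- have -> : (fun x => complex.Re ((a +i* b)%C * f x)) =
      (fun x => a * complex.Re (f x)) \- (fun x => b * complex.Im (f x)).
    by apply/funext => x /=; case: (f x).
  by apply: measurable_funB; apply: measurable_funM => //; exact: measurable_cst.
- have -> : (fun x => complex.Im ((a +i* b)%C * f x)) =
      (fun x => a * complex.Im (f x)) \+ (fun x => b * complex.Re (f x)).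
    by apply/funext => x /=; case: (f x).
  by apply: measurable_funD; apply: measurable_funM => //; exact: measurable_cst.
Qed.

Lemma L1w_normZ (c : R[i]) f : cmeasurable_fun period f ->
  N (fun x => c * f x) = ((normc c)%:E * N f)%E.
Proof.
move=> mf; have c0 := normc_ge0 c; rewrite /L1w_norm -ge0_integralZl //.
- by apply: eq_integral => x _; rewrite normcM -EFinM mulrA.
- exact: measurable_period.
- exact: measurable_weighted.
- by move=> x; exact: weighted_ge0.
Qed.

Lemma trig_sum_scale (c : R[i]) s x :
  trig_sum [seq (p.1, c * p.2) | p <- s] x = c * trig_sum s x.
Proof. by rewrite /trig_sum big_map mulr_sumr; apply: eq_bigr => p _; rewrite /= mulrA. Qed.

Lemma trig_approxZ (c : R[i]) f : trig_approx f -> trig_approx (fun x => c * f x).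
Proof.
move=> [mf af]; split; first exact: cmeasurable_scale.
move=> d d0.
have c1 : 0 < normc c + 1 by rewrite ltr_wpDl ?normc_ge0.
have [s hs] := af _ (divr_gt0 d0 c1).
exists [seq (p.1, c * p.2) | p <- s].
have -> : (fun x => c * f x) - trig_sum [seq (p.1, c * p.2) | p <- s] =
    (fun x => c * (f - trig_sum s) x).
  by apply/funext => x; rewrite !fctE trig_sum_scale mulrBr.
rewrite L1w_normZ; last first.
  by apply: cmeasurable_funD mf _; apply/cmeasurable_funN/measurable_trig_sum.
apply: (@le_trans _ _ ((normc c)%:E * (d / (normc c + 1))%:E)%E).
  by rewrite lee_wpmul2l // lee_fin normc_ge0.
rewrite -EFinM lee_fin mulrA ler_pdivrMr // mulrC ler_wpM2l ?(ltW d0) //; lra.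
Qed.

Lemma trig_approxN f : trig_approx f -> trig_approx (- f).
Proof.
move=> /(trig_approxZ (-1)).
by congr trig_approx; apply/funext => x; rewrite mulN1r.
Qed.

(** Dominated convergence. The null set [Z] allows for the points where the
    polynomials of Stone do not converge to the indicator function. *)
Lemma trig_approx_lim (g : nat -> R -> R[i]) (f : R -> R[i]) (h : R -> R) (Z : set R) :
  (forall n, trig_approx (g n)) -> cmeasurable_fun period f ->
  measurable_fun period (fun x => h x * mu x) ->
  (\int[lebesgue_measure]_(x in period) (h x * mu x)%:E < +oo)%E ->
  (forall n x, period x -> normc (f x - g n x) <= h x) ->
  lebesgue_measure.-negligible Z ->
  (forall x, period x -> ~ Z x -> normc (f x - g n x) @[n --> \oo] --> 0) ->
  trig_approx f.
Proof.
move=> ag mf mh hfin fgh Z0 cfg; split=> // d d0.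
have mfg n : cmeasurable_fun (@period R) (f - g n).
  by apply: cmeasurable_funD mf _; apply: cmeasurable_funN; case: (ag n).
have h0 x : period x -> 0 <= h x.
  by move=> px; apply: le_trans (fgh 0%N x px); exact: normc_ge0.
have H1 : {ae lebesgue_measure, forall x, period x ->
    (fun n => (normc (f x - g n x) * mu x)%:E) @ \oo --> 0%E}.
  case: Z0 => A [mA A0 ZA]; exists A; split=> // x /= nx; apply: ZA.
  apply: contrapT => nZ; apply: nx => px.
  apply/cvg_EFin; first by near=> n.
  rewrite -[X in _ --> X](mul0r (mu x)).
  apply: cvgM; [exact: cfg|exact: cvg_cst].
have H2 : lebesgue_measure.-integrable period (fun x => (h x * mu x)%:E).
  apply/integrableP; split; first exact/measurable_EFinP.
  apply: le_lt_trans hfin; rewrite le_eqVlt; apply/orP; left; apply/eqP.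
  apply: eq_integral => x; rewrite inE => px.
  by rewrite gee0_abs // lee_fin mulr_ge0 ?h0 ?mu_ge0.
have H3 : {ae lebesgue_measure, forall x n, period x ->
    (`|(normc (f x - g n x) * mu x)%:E| <= (h x * mu x)%:E)%E}.
  apply: aeW => x n px.
  rewrite gee0_abs ?lee_fin ?mulr_ge0 ?normc_ge0 ?mu_ge0 //.
  by rewrite ler_wpM2r ?mu_ge0 // fgh.
have [_ _] := @dominated_convergence _ _ R lebesgue_measure period measurable_period
  (fun n x => (normc (f x - g n x) * mu x)%:E) (fun _ => 0%E) (fun x => (h x * mu x)%:E)
  (fun n => measurable_weighted mmu (mfg n)) (measurable_cst _) H1 H2 H3.
rewrite integral0 => /fine_cvgP[finN cN].
have d2 : 0 < d / 2 by rewrite divr_gt0.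
have [n hn] : exists n, (N (f - g n)%R <= (d / 2)%:E)%E.
  have nd : \forall n \near \oo, (N (f - g n)%R <= (d / 2)%:E)%E.
    near=> n.
    have fn : N (f - g n)%R \is a fin_num by near: n; exact: finN.
    rewrite -(fineK fn) lee_fin ltW //; near: n.
    exact: (cvgr_lt _ cN).
  by have [n _ /(_ n (leqnn n)) hn] := nd; exists n.
have [s hs] := (ag n).2 _ d2; exists s.
have -> : f - trig_sum s = (f - g n) + (g n - trig_sum s) by rewrite addrA subrK.
apply: le_trans (L1w_normD _ _ _ _) _ => //.
  apply: cmeasurable_funD; first by case: (ag n).
  exact/cmeasurable_funN/measurable_trig_sum.
by rewrite [d]splitr EFinD leeD.
Unshelve. all: by end_near. Qed.

Lemma finite_weight (h : R -> R) (M : R) : (forall x, period x -> 0 <= h x <= M) ->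
  measurable_fun period h ->
  (\int[lebesgue_measure]_(x in period) (h x * mu x)%:E < +oo)%E.
Proof.
move=> hM mh.
apply: (@le_lt_trans _ _ (\int[lebesgue_measure]_(x in period) M%:E)%E).
  apply: ge0_le_integral => //.
  - exact: measurable_period.
  - by move=> x px; case/andP: (hM x px) => h0 _; rewrite lee_fin mulr_ge0 ?mu_ge0.
  - by apply/measurable_EFinP; exact: measurable_funM.
  - move=> x px; case/andP: (hM x px) => h0 h1; case/andP: (mu01 px) => m0 m1.
    by rewrite lee_fin; apply: le_trans h1; rewrite ler_piMr.
rewrite integral_cst; last exact: measurable_period.
by rewrite [X in (_ * X)%E]lebesgue_period -EFinM ltry.
Qed.

End TrigApproximation.

Section TrigPolynomials.
Context {R : realType}.

Definition is_trig (g : R -> R[i]) := exists s, g = trig_sum s.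

Lemma is_trig_cst c : is_trig (fun _ => c).
Proof.
exists [:: (0, c)]; apply/funext => x.
by rewrite trig_sum_cons trig_sum_nil mul0r /cis cos0 sin0 mulr1 addr0.
Qed.

Lemma is_trigD f g : is_trig f -> is_trig g -> is_trig (fun x => f x + g x).
Proof.
move=> [s ->] [t ->]; exists (s ++ t).
by apply/funext => x; rewrite trig_sum_cat.
Qed.

Lemma is_trigM f g : is_trig f -> is_trig g -> is_trig (fun x => f x * g x).
Proof.
move=> [s ->] [t ->].
exists [seq (p.1 + q.1, p.2 * q.2) | p <- s, q <- t]; apply/funext => x.
rewrite /trig_sum big_allpairs_dep mulr_suml; apply: eq_bigr => p _.
rewrite mulr_sumr; apply: eq_bigr => q _ /=.
by rewrite rmorphD /= mulrDl cisD; ring.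
Qed.

Lemma is_trigX f n : is_trig f -> is_trig (fun x => f x ^+ n).
Proof.
move=> tf; elim: n => [|n IH]; first exact: is_trig_cst.
by under eq_fun do rewrite exprS; exact: is_trigM.
Qed.

Lemma is_trig_cos (b : R) : is_trig (fun x => (cos (x - b))%:C%C).
Proof.
exists [:: (1, (2^-1)%:C%C * cis (- b)); (-1, (2^-1)%:C%C * cis b)]; apply/funext => x.
rewrite !trig_sum_cons trig_sum_nil addr0 /= mul1r mulN1r -!mulrA -!cisD -mulrDr.
have -> : b + - x = - (- b + x) by ring.
by rewrite cis_conj -rmorphM /= [- b + x]addrC; congr _%:C%C; field.
Qed.

(** Stone's polynomials, which separate [v < 1/2] from [v > 1/2] on the unit
    interval: by Bernoulli's inequality they are close to 1 where
    [2^n * v^n = (2 * v)^n] is small, and close to 0 where it is large. *)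
Definition stone (n : nat) (v : R) : R := (1 - v ^+ n) ^+ (2 ^ n).

Lemma stone01 n v : 0 <= v <= 1 -> 0 <= stone n v <= 1.
Proof.
move=> /andP[v0 v1]; have vn := exprn_ile1 n v0 v1; have vn0 := exprn_ge0 n v0.
by rewrite exprn_ge0 ?subr_ge0 //= exprn_ile1 ?subr_ge0 // lerBlDr lerDl.
Qed.

Lemma bernoulli_ge (y : R) n : -1 <= y -> 1 + n%:R * y <= (1 + y) ^+ n.
Proof.
move=> y1; elim: n => [|n IH]; first by rewrite mul0r addr0 expr0.
rewrite exprS; apply: (@le_trans _ _ ((1 + y) * (1 + n%:R * y))); last first.
  by rewrite ler_wpM2l //; lra.
have : 0 <= n%:R * y ^+ 2 by rewrite mulr_ge0 ?sqr_ge0.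
rewrite -natr1; nra.
Qed.

Lemma stone_cvg1 (v : R) : 0 <= v < 2^-1 -> stone n v @[n --> \oo] --> (1 : R).
Proof.
move=> /andP[v0 v1].
apply: (@squeeze_cvgr _ _ _ _ (fun n => 1 - (2 * v) ^+ n) (fun _ => 1)).
- near=> n; apply/andP; split; last first.
    by have /andP[] : 0 <= stone n v <= 1 by apply: stone01; apply/andP; split=> //; lra.
  have vn : v ^+ n <= 1 by apply: exprn_ile1 => //; lra.
  have := @bernoulli_ge (- v ^+ n) (2 ^ n); rewrite lerN2 => /(_ vn).
  by rewrite natrX mulrN -exprMn.
- rewrite -[X in _ --> X]subr0; apply: cvgB; first exact: cvg_cst.
  by apply: cvg_expr; rewrite ger0_norm; [lra|rewrite mulr_ge0].
- exact: cvg_cst.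
Unshelve. all: by end_near. Qed.

Lemma stone_cvg0 (v : R) : 2^-1 < v <= 1 -> stone n v @[n --> \oo] --> (0 : R).
Proof.
move=> /andP[v0 v1]; have vp : 0 < v by lra.
apply: (@squeeze_cvgr _ _ _ _ (fun _ => 0) (fun n => (2 * v)^-1 ^+ n)).
- near=> n; have /andP[s0 s1] : 0 <= stone n v <= 1.
    by apply: stone01; apply/andP; split=> //; lra.
  rewrite s0 /=.
  have w0 : 0 < v ^+ n by rewrite exprn_gt0.
  have w1 : v ^+ n <= 1 by apply: exprn_ile1 => //; lra.
  have b : (2 * v) ^+ n <= (1 + v ^+ n) ^+ (2 ^ n).
    have := @bernoulli_ge (v ^+ n) (2 ^ n); rewrite natrX -exprMn => h.
    have := h ltac:(lra); lra.
  have P0 : 0 < (2 * v) ^+ n by rewrite exprn_gt0 // mulr_gt0.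
  rewrite exprVn -[leRHS]mul1r ler_pdivlMr //.
  apply: (@le_trans _ _ (stone n v * (1 + v ^+ n) ^+ (2 ^ n))).
    by rewrite ler_wpM2l.
  rewrite /stone -exprMn; apply: exprn_ile1.
    by rewrite mulr_ge0 //; lra.
  have := sqr_ge0 (v ^+ n); nra.
- exact: cvg_cst.
- apply: cvg_expr; rewrite ger0_norm ?invr_ge0 ?mulr_ge0 ?(ltW vp) //.
  by rewrite invf_lt1 ?mulr_gt0 //; lra.
Unshelve. all: by end_near. Qed.

(** For [0 < x < 2 pi] the sign of [cos (x - a/2) - cos (a/2)] tells whether
    [x < a], since the difference is [2 sin (x/2) sin ((a-x)/2)]. *)
Definition arc (a x : R) : R := 2^-1 - (cos (x - a / 2) - cos (a / 2)) / 4.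

Lemma arc01 a x : 0 <= arc a x <= 1.
Proof.
rewrite /arc; have := cos_le1 (x - a / 2); have := cos_geN1 (x - a / 2).
have := cos_le1 (a / 2); have := cos_geN1 (a / 2).
by move=> *; apply/andP; split; lra.
Qed.

Lemma arcE a x : arc a x = 2^-1 - sin (x / 2) * sin ((a - x) / 2) / 2.
Proof.
rewrite /arc; congr (_ - _).
set p := x / 2; set q := (a - x) / 2.
have -> : x - a / 2 = p - q by rewrite /p /q; field.
have -> : a / 2 = p + q by rewrite /p /q; field.
by rewrite cosB cosD; field.
Qed.

Lemma arc_lt a x : 0 < x -> x < a -> a <= 2 * pi -> arc a x < 2^-1.
Proof.
move=> x0 xa a2; rewrite arcE ltrBlDr ltrDl divr_gt0 // mulr_gt0 //;
  by apply: sin_gt0_pi; apply/andP; split; lra.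
Qed.

Lemma arc_gt a x : 0 < a -> a < x -> x < 2 * pi -> 2^-1 < arc a x.
Proof.
move=> a0 ax x2; rewrite arcE -mulrN -opprB.
have s1 : 0 < sin (x / 2) by apply: sin_gt0_pi; apply/andP; split; lra.
have s2 : 0 < sin ((x - a) / 2) by apply: sin_gt0_pi; apply/andP; split; lra.
have -> : (- (x - a)) / 2 = - ((x - a) / 2) by field.
by have := mulr_gt0 s1 s2; rewrite sinN; lra.
Qed.

Lemma is_trig_stone_arc n a : is_trig (fun x => (stone n (arc a x))%:C%C).
Proof.
have tarc : is_trig (fun x => (arc a x)%:C%C).
  have -> : (fun x => (arc a x)%:C%C) = (fun x =>
      (2^-1 + cos (a / 2) / 4)%:C%C + (- 4^-1)%:C%C * (cos (x - a / 2))%:C%C).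
    by apply/funext => x; rewrite -rmorphM -rmorphD /=; congr _%:C%C; rewrite /arc; field.
  apply: is_trigD; first exact: is_trig_cst.
  by apply: is_trigM; [exact: is_trig_cst|exact: is_trig_cos].
have -> : (fun x => (stone n (arc a x))%:C%C) =
    (fun x => (1 + (-1) * (arc a x)%:C%C ^+ n) ^+ (2 ^ n)).
  apply/funext => x; rewrite mulN1r -!rmorphXn /= -[1]/(1%:C%C) -rmorphB /=.
  by rewrite -rmorphXn.
apply: is_trigX; apply: is_trigD; first exact: is_trig_cst.
by apply: is_trigM; [exact: is_trig_cst|exact: is_trigX].
Qed.

End TrigPolynomials.

Section DensityOfTrigSums.
Context {R : realType}.
Variable mu : R -> R.
Hypotheses (mmu : measurable_fun (@period R) mu)
  (mu01 : forall x, period x -> 0 <= mu x <= 1).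

Definition cindic (A : set R) : R -> R[i] := fun x => (\1_A x)%:C%C.

Lemma measurable_cindic (A : set R) : measurable A -> cmeasurable_fun period (cindic A).
Proof. by move=> mA; split; [exact: measurable_indic|exact: measurable_cst]. Qed.

Lemma indic01 (A : set R) x : 0 <= (\1_A x : R) <= 1.
Proof. by rewrite indicE; case: (_ \in _); rewrite ?lexx ?ler01. Qed.

(** On the period a ray is an arc that starts at 0, so the polynomials of Stone
    composed with [arc a] converge to its indicator function except at the
    points 0, [a] and [2 * pi]. *)
Lemma trig_approx_ray (a : R) : trig_approx mu (cindic `]-oo, a[).
Proof.
have mray : measurable (`]-oo, a[%classic : set R) by exact: measurable_itv.
pose Z : set R := [set 0; a; 2 * pi].
have Z0 : lebesgue_measure.-negligible Z.
  exists Z; split=> //; first by do !apply: measurableU; exact: measurable_set1.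
  by apply/countable_lebesgue_measure0/finite_set_countable; rewrite !finite_setU; do !split.
have lim (g : nat -> R -> R) :
    (forall n, is_trig (fun x => (g n x)%:C%C)) -> (forall n x, 0 <= g n x <= 1) ->
    (forall x, period x -> ~ Z x -> g n x @[n --> \oo] --> (\1_(`]-oo, a[) x : R)) ->
    trig_approx mu (cindic `]-oo, a[).
  move=> tg g01 cg.
  apply: (@trig_approx_lim _ mu mmu mu01 (fun n x => (g n x)%:C%C) _ (fun _ => 1) Z) => //.
  - by move=> n; have [s ->] := tg n; exact: trig_approx_trig.
  - exact: measurable_cindic.
  - by under eq_fun do rewrite mul1r.
  - by apply: (@finite_weight _ mu mmu mu01 (fun _ => 1) 1) => // x _; rewrite ler01 lexx.
  - move=> n x _; rewrite /cindic -rmorphB normc_real ler_norml.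
    have /andP[h0 h1] := g01 n x; have /andP[h2 h3] := indic01 `]-oo, a[ x.
    by apply/andP; split; lra.
  - move=> x px nZ.
    have -> : (fun n => normc (cindic `]-oo, a[ x - (g n x)%:C%C)) =
        (fun n => `|(\1_(`]-oo, a[) x : R) - g n x|).
      by apply/funext => n; rewrite /cindic -rmorphB normc_real.
    apply/norm_cvg0P; rewrite -[X in _ --> X](subrr (\1_(`]-oo, a[) x : R)).
    by apply: cvgB; [exact: cvg_cst|exact: cg].
have out x : period x -> ~ Z x -> [/\ 0 < x, x < 2 * pi & x != a].
  rewrite /period /Z /= in_itv /= => /andP[x0 x2] nZ; split.
  - by rewrite lt_def x0 andbT; apply/eqP => E; apply: nZ; left; left.
  - by rewrite lt_def x2 andbT; apply/eqP => E; apply: nZ; right.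
  - by apply/eqP => E; apply: nZ; left; right.
have [a0|a0] := leP a 0.
  apply: (lim (fun _ _ => 0)) => [n|n x|x /out h /h[x0 _ _]]; first exact: is_trig_cst.
    by rewrite lexx ler01.
  rewrite indicE memNset ?in_itv /=; first exact: cvg_cst.
  by apply/negP; rewrite -leNgt; exact: le_trans a0 (ltW x0).
have [a2|a2] := ltP (2 * pi) a.
  apply: (lim (fun _ _ => 1)) => [n|n x|x /out h /h[_ x2 _]]; first exact: is_trig_cst.
    by rewrite ler01 lexx.
  by rewrite indicE mem_set ?in_itv /=; [exact: cvg_cst|exact: lt_trans x2 a2].
apply: (lim (fun n x => stone n (arc a x))) => [n|n x|x /out h /h[x0 x2 xa]].
- exact: is_trig_stone_arc.
- by apply: stone01; exact: arc01.
- have [xa'|ax] := ltP x a.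
    rewrite indicE mem_set ?in_itv //=; apply: stone_cvg1.
    by have /andP[-> _] := arc01 a x; exact: arc_lt.
  rewrite indicE memNset ?in_itv /=; last by apply/negP; rewrite -leNgt.
  apply: stone_cvg0; have /andP[_ ->] := arc01 a x; rewrite andbT.
  by apply: arc_gt => //; rewrite lt_def xa.
Qed.

(** Rays are stable under intersection and generate the Borel sets, which is what
    Dynkin's argument requires. *)
Lemma trig_approx_indic (A : set R) : measurable A -> trig_approx mu (cindic A).
Proof.
move=> mA.
have E : @measurable _ (measurableTypeR R) = <<s @RGenInftyO.G R >>.
  exact: RGenInftyO.measurableE.
apply: (dynkin_induction (T := measurableTypeR R) (P := fun A => trig_approx mu (cindic A)) E).
- move=> _ _ [x ->] [y ->]; exists (Num.min x y).
  by apply/seteqP; split => z /=; rewrite !in_itv /= lt_min => /andP.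
- suff -> : cindic [set: R] = trig_sum [:: (0, 1)] by exact: trig_approx_trig.
  apply/funext => x; rewrite /cindic indicT trig_sum_cons trig_sum_nil mul0r.
  by rewrite /cis cos0 sin0 mulr1 addr0.
- by move=> _ [x ->]; exact: trig_approx_ray.
- move=> S mS aS.
  have -> : cindic (~` S) = trig_sum [:: (0, 1)] - cindic S.
    apply/funext => x; rewrite !fctE trig_sum_cons trig_sum_nil mul0r.
    rewrite /cis cos0 sin0 mulr1 addr0 /cindic !indicE in_setC.
    by case: (x \in S); rewrite ?subrr ?subr0.
  by apply: trig_approxD => //; [exact: trig_approx_trig|exact: trig_approxN].
- move=> F mF tF aF.
  have part n : trig_approx mu (cindic (\big[setU/set0]_(k < n) F k)).
    elim: n => [|n IH].
      rewrite big_ord0; have -> : cindic set0 = 0.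
        by apply/funext => x; rewrite /cindic indicE in_set0.
      exact: trig_approx0.
    rewrite big_ord_recr /=.
    have -> : cindic (\big[setU/set0]_(i < n) F i `|` F n) =
        cindic (\big[setU/set0]_(i < n) F i) + cindic (F n).
      apply/funext => x; rewrite !fctE /cindic -rmorphD; congr _%:C%C.
      rewrite !indicE in_setU.
      have [xn|xn] := boolP (x \in F n); last by rewrite orbF addr0.
      have [xU|] := boolP (x \in \big[setU/set0]_(i < n) F i); last by rewrite add0r.
      move: xU; rewrite inE -bigcup_mkord => -[i /= ni Fi]; rewrite inE in xn.
      have in' : i = n by apply: tF => //; exists x.
      by rewrite in' ltnn in ni.
    by apply: trig_approxD.
  have mU : measurable (\bigcup_k F k : set R) by apply: bigcupT_measurable.
  apply: (trig_approx_lim (h := fun _ => 1) (Z := set0) mmu mu01 part) => //.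
  - exact: measurable_cindic.
  - by under eq_fun do rewrite mul1r.
  - by apply: (@finite_weight _ mu mmu mu01 (fun _ => 1) 1) => // x _; rewrite ler01 lexx.
  - move=> n x _; rewrite /cindic -rmorphB normc_real ler_norml.
    have /andP[h0 h1] := indic01 (\bigcup_k F k) x.
    have /andP[h2 h3] := indic01 (\big[setU/set0]_(k < n) F k) x.
    by apply/andP; split; lra.
  - exact: negligible_set0.
  - move=> x _ _; apply: cvg_near_cst.
    have [[k _ Fk]|nx] := pselect ((\bigcup_k F k) x).
      exists k.+1 => // n kn.
      have xU : (\bigcup_k F k) x by exists k.
      have xn : (\big[setU/set0]_(k < n) F k) x by rewrite -bigcup_mkord; exists k.
      by rewrite /cindic !indicE !mem_set // -rmorphB subrr normc_real normr0.
    apply: nearW => n.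
    have xn : ~ (\big[setU/set0]_(k < n) F k) x.
      by rewrite -bigcup_mkord => -[k _ Fk]; apply: nx; exists k.
    by rewrite /cindic !indicE !memNset // -rmorphB subrr normc_real normr0.
- by rewrite -E.
Qed.

Import HBNNSimple.

(** The simple functions that increase to [f] stay between 0 and [f], so [f]
    itself dominates the errors. *)
Lemma trig_approx_ge0 (f : R -> R) : (forall x, 0 <= f x) -> measurable_fun period f ->
  (\int[lebesgue_measure]_(x in period) (f x * mu x)%:E < +oo)%E ->
  trig_approx mu (fun x => (f x)%:C%C).
Proof.
move=> f0 mf ffin.
have mf' : measurable_fun period (EFin \o f) by exact/measurable_EFinP.
pose g := nnsfun_approx measurable_period mf'.
have f0' x : period x -> (0 <= (EFin \o f) x)%E by move=> _; rewrite lee_fin.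
have cg x : period x -> g n x @[n --> \oo] --> f x.
  by move=> px; have /fine_cvgP[_] := cvg_nnsfun_approx measurable_period mf' f0' px.
have gf n x : period x -> 0 <= g n x <= f x.
  move=> px; apply/andP; split; first exact: fun_ge0.
  rewrite -(cvg_lim _ (cg x px)) //; apply: nondecreasing_cvgn_le.
    by move=> i j ij; exact/lefP/nd_nnsfun_approx.
  by apply/cvg_ex; exists (f x); exact: cg.
have ag n : trig_approx mu (fun x => (g n x)%:C%C).
  pose s := finmap.enum_fset (fset_set (range (g n))).
  have -> : (fun x => (g n x)%:C%C) = \sum_(i < size s)
      (fun x => (s`_i)%:C%C * cindic (g n @^-1` [set s`_i]) x).
    apply/funext => x; rewrite fct_sumE [g n x]fimfunEord rmorph_sum.
    by apply: eq_bigr => i _; rewrite rmorphM.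
  elim/big_ind: _ => [|h k ah ak|i _]; first exact: trig_approx0.
    exact: trig_approxD.
  by apply/trig_approxZ/trig_approx_indic.
apply: (trig_approx_lim (h := f) (Z := set0) mmu mu01 ag) => //.
- exact: measurable_funM.
- move=> n x px; rewrite -rmorphB normc_real ler_norml.
  have /andP[g0 g1] := gf n x px.
  by apply/andP; split; have := f0 x; lra.
- exact: negligible_set0.
- move=> x px _.
  have -> : (fun n => normc ((f x)%:C%C - (g n x)%:C%C)) = (fun n => `|f x - g n x|).
    by apply/funext => n; rewrite -rmorphB normc_real.
  apply/norm_cvg0P; rewrite -[X in _ --> X](subrr (f x)).
  by apply: cvgB; [exact: cvg_cst|exact: cg].
Qed.

(** The positive and negative parts of the real and imaginary parts are at most
    the norm of [f], and therefore lie in the weighted space as well. *)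
Lemma trig_approx_L1w (f : R -> R[i]) : L1w mu f -> trig_approx mu f.
Proof.
move=> [[m1 m2] ffin].
have part (h : R -> R) : measurable_fun period h ->
    (forall x, `|h x| <= normc (f x)) -> trig_approx mu (fun x => (h x)%:C%C).
  move=> mh hf.
  have fin (k : R -> R) : measurable_fun period k ->
      (forall x, 0 <= k x <= normc (f x)) -> trig_approx mu (fun x => (k x)%:C%C).
    move=> mk kf; apply: trig_approx_ge0 => // [x|]; first by case/andP: (kf x).
    apply: le_lt_trans ffin; apply: ge0_le_integral => //.
    - exact: measurable_period.
    - move=> x px; case/andP: (kf x) (mu01 px) => k0 _ /andP[u0 _].
      by rewrite lee_fin mulr_ge0.
    - by apply/measurable_EFinP; exact: measurable_funM.
    - exact: measurable_weighted.
    - move=> x px; case/andP: (kf x) (mu01 px) => _ k1 /andP[u0 _].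
      by rewrite lee_fin ler_wpM2r.
  have -> : (fun x => (h x)%:C%C) =
      (fun x => (h^\+ x)%:C%C) + (- (fun x => (h^\- x)%:C%C)).
    by apply/funext => x; rewrite !fctE -rmorphB; congr _%:C%C;
      rewrite -[in LHS](funrposBneg h).
  have hpn x : h^\+ x + h^\- x = `|h x| by exact: (congr1 (fun k => k x) (funrposDneg h)).
  apply: trig_approxD => //; last apply: trig_approxN => //.
  - apply: fin => [|x]; first exact: measurable_funrpos.
    by rewrite funrpos_ge0 (le_trans _ (hf x)) // -hpn lerDl funrneg_ge0.
  - apply: fin => [|x]; first exact: measurable_funrneg.
    by rewrite funrneg_ge0 (le_trans _ (hf x)) // -hpn lerDr funrpos_ge0.
have -> : f = (fun x => (complex.Re (f x))%:C%C) +
    (fun x => 'i%C * (complex.Im (f x))%:C%C).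
  by apply/funext => x; rewrite !fctE -complexE.
apply: trig_approxD => //; last apply: trig_approxZ => //.
  by apply: part => // x; exact: normc_Re.
by apply: part => // x; exact: normc_Im.
Qed.

End DensityOfTrigSums.

(** * Construction of the weight *)

Section WeightConstruction.
Context {R : realType}.
Variables (e : nat -> R -> R) (tau : nat -> R) (delta : R).
Hypotheses (ce : forall k, continuous (e k)) (e_ge0 : forall k x, 0 <= e k x)
  (tau_gt0 : forall k, 0 < tau k) (delta_ge0 : 0 <= delta).
Hypothesis small_bad : forall k,
  (lebesgue_measure (period `&` [set x | (tau k < e k x)%R]) <= (delta / 2 ^+ k.+1)%:E)%E.

Let bad k : set R := period `&` [set x | tau k < e k x].
Let excess k x : R := Num.max 0 (e k x / tau k - 1).
Let total x : \bar R := (\sum_(0 <= k <oo) (excess k x)%:E)%E.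

(** The sum may be infinite on a null set, where [fine] makes the weight 1. *)
Definition taming_weight (x : R) : R := (1 + fine (total x))^-1.

Let excess_ge0 k x : 0 <= excess k x.
Proof. by rewrite /excess le_max lexx. Qed.

Let total_ge0 x : (0 <= total x)%E.
Proof. by apply: nneseries_ge0 => k _ _; rewrite lee_fin excess_ge0. Qed.

Let excess0 k x : period x -> ~ bad k x -> excess k x = 0.
Proof.
move=> px nb; apply/max_idPl; rewrite subr_le0 ler_pdivrMr // mul1r leNgt.
by apply/negP => h; apply: nb.
Qed.

Let measurable_bad k : measurable (bad k).
Proof. by apply: measurable_superlevel; exact: ce. Qed.

Let measurable_tail m : measurable (\bigcup_k bad (m + k)%N).
Proof. by apply: bigcupT_measurable => k; exact: measurable_bad. Qed.

Let tail_small m : (lebesgue_measure (\bigcup_k bad (m + k)%N) <= (delta / 2 ^+ m)%:E)%E.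
Proof.
apply: (@le_trans _ _ (\sum_(0 <= k <oo) lebesgue_measure (bad (m + k)%N))%E).
  apply: measure_sigma_subadditive => // [k|]; [exact: measurable_bad|exact: measurable_tail].
apply: (@le_trans _ _ (\sum_(0 <= k <oo) ((delta / 2 ^+ m) / (2 ^ k.+1)%:R)%:E)%E).
  apply: lee_nneseries => k _ //.
  apply: le_trans (small_bad _) _; rewrite lee_fin natrX -mulrA -invfM -exprD.
  by rewrite addnS.
by apply: (epsilon_trick0 xpredT); rewrite divr_ge0 // exprn_ge0.
Qed.

Let measurable_total : measurable_fun (@period R) total.
Proof.
apply: ge0_emeasurable_sum => [k x _ _|k _]; first by rewrite lee_fin excess_ge0.
apply/measurable_EFinP; apply: measurable_maxr; first exact: measurable_cst.
apply: measurable_funTS; apply: continuous_measurable_fun => x.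
by apply: cvgB; [apply: cvgM; [exact: ce|exact: cvg_cst]|exact: cvg_cst].
Qed.

Lemma measurable_taming_weight : measurable_fun (@period R) taming_weight.
Proof.
have -> : taming_weight = (fun y : R => y `^ (-1)) \o (fun x => 1 + fine (total x)).
  apply/funext => x /=; rewrite powR_inv1 // addr_ge0 // fine_ge0 //.
apply: measurableT_comp; first exact: measurable_powR.
apply: measurable_funD; first exact: measurable_cst.
by apply: measurableT_comp; [exact: fine_measurable|exact: measurable_total].
Qed.

Lemma taming_weight01 x : 0 < taming_weight x <= 1.
Proof.
have t0 : 0 <= fine (total x) := fine_ge0 (total_ge0 x).
by rewrite /taming_weight invr_gt0 invf_le1 ?ltr_wpDr //= ?lerDl t0.
Qed.

Lemma taming_weight_neq1 :
  (lebesgue_measure (period `&` [set x | taming_weight x <> 1%R]) <= delta%:E)%E.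
Proof.
apply: (@le_trans _ _ (lebesgue_measure (\bigcup_k bad (0 + k)%N))); last first.
  by apply: le_trans (tail_small 0) _; rewrite expr0 divr1.
apply: le_measure; rewrite ?inE; try exact: measurable_tail.
  have -> : [set x | taming_weight x <> 1%R] = taming_weight @^-1` (~` [set 1]).
    by apply/seteqP; split.
  apply: measurable_taming_weight; first exact: measurable_period.
  by apply: measurableC; exact: measurable_set1.
move=> x [px /= mx]; apply: contrapT => nb; apply: mx.
rewrite /taming_weight /total eseries0 ?addr0 ?invr1 // => k _ _.
by rewrite excess0 // => bk; apply: nb; exists k.
Qed.

Let total_infty : lebesgue_measure.-negligible (period `&` [set x | total x = +oo%E]).
Proof.
pose Z := \bigcap_m \bigcup_k bad (m + k)%N.
have mZ : measurable Z by apply: bigcapT_measurable => m; exact: measurable_tail.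
exists Z; split=> //.
  apply/eqP; rewrite eq_le measure_ge0 andbT.
  apply/lee_addgt0Pr => r r0; rewrite add0e.
  have [m hm] := exists_nat_ge (delta / r).
  apply: (@le_trans _ _ (lebesgue_measure (\bigcup_k bad (m + k)%N))).
    apply: le_measure; rewrite ?inE; [exact: mZ|exact: measurable_tail|].
    by move=> x /(_ m); exact.
  apply: le_trans (tail_small m) _.
  rewrite lee_fin ler_pdivrMr ?exprn_gt0 // mulrC -ler_pdivrMr //.
  by apply: le_trans hm _; rewrite -natrX ler_nat ltnW // ltn_expl.
move=> x [px /= tx] m _; apply: contrapT => nb.
suff : total x \is a fin_num by rewrite tx.
rewrite /total (nneseries_split 0 m); last by move=> k _; rewrite lee_fin excess_ge0.
rewrite add0n eseries0 ?adde0; last first.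
  move=> k mk _; rewrite excess0 // => bk; apply: nb; exists (k - m)%N => //.
  by rewrite subnKC.
by rewrite sumEFin.
Qed.

(** Where the total excess is finite it dominates each of its terms, and this
    makes the weight tame all the [e k] at once. *)
Lemma taming_weightP k :
  (\int[lebesgue_measure]_(x in period) (e k x * taming_weight x)%:E <= (2 * pi * tau k)%:E)%E.
Proof.
have me : measurable_fun (@period R) (e k).
  by apply: measurable_funTS; apply: continuous_measurable_fun; exact: ce.
apply: (@le_trans _ _ (\int[lebesgue_measure]_(x in period) (tau k)%:E)%E); last first.
  rewrite integral_cst; last exact: measurable_period.
  by rewrite [X in (_ * X)%E]lebesgue_period -EFinM lee_fin mulrC.
apply: ae_ge0_le_integral => //.
- exact: measurable_period.
- by move=> x _; rewrite lee_fin mulr_ge0 //; case/andP: (taming_weight01 x) => /ltW.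
- by apply/measurable_EFinP; apply: measurable_funM => //; exact: measurable_taming_weight.
- by move=> x _; rewrite lee_fin ltW.
- case: total_infty => Z [mZ Z0 hZ]; exists Z; split=> // x /= nx; apply: hZ.
  have px : period x by apply: contrapT => npx; apply: nx => px.
  split=> //=; apply: contrapT => tx; apply: nx => _.
  have fin : total x \is a fin_num by rewrite ge0_fin_numE // ltey; apply/eqP.
  have w0 : 0 < 1 + fine (total x) by rewrite ltr_wpDr // fine_ge0.
  rewrite lee_fin /taming_weight ler_pdivrMr // mulrC -ler_pdivrMr // -lerBlDl.
  apply: (@le_trans _ _ (excess k x)); first by rewrite /excess le_max lexx orbT.
  rewrite -lee_fin fineK // /total (nneseriesD1 (n := k)) //.
    by rewrite leeDl // nneseries_ge0 // => i _ _; rewrite lee_fin excess_ge0.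
  by move=> i _; rewrite lee_fin excess_ge0.
Qed.

End WeightConstruction.

(** * Steering and rearrangement *)

Section Steering.
Context {R : realType} {V : zmodType} {I : eqType}.
Variables (X : set V) (N : V -> R) (u : I -> V).
Hypotheses (X0 : X 0) (XD : forall x y, X x -> X y -> X (x + y))
  (XN : forall x, X x -> X (- x)) (Xu : forall k, X (u k)).
Hypotheses (N0 : N 0 = 0) (N_ge0 : forall x, 0 <= N x)
  (ND : forall x y, X x -> X y -> N (x + y) <= N x + N y)
  (NN : forall x, N (- x) = N x) (NMn : forall x n, X x -> N (x *+ n) = N x *+ n).

Definition psum (r : seq I) : V := \sum_(k <- r) u k.

Lemma psum_cat r1 r2 : psum (r1 ++ r2) = psum r1 + psum r2.
Proof. by rewrite /psum big_cat. Qed.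

Lemma X_sum (J : Type) (js : seq J) (t : J -> V) :
  (forall j, X (t j)) -> X (\sum_(j <- js) t j).
Proof. by move=> Xt; elim/big_ind: _ => //; exact: XD. Qed.

Lemma X_psum r : X (psum r).
Proof. exact: X_sum. Qed.

Lemma X_Mn x n : X x -> X (x *+ n).
Proof.
by move=> Xx; elim: n => [|n IH]; [rewrite mulr0n|rewrite mulrSr; exact: XD].
Qed.

Lemma N_subC x y : N (x - y) = N (y - x).
Proof. by rewrite -NN opprB. Qed.

Lemma N_triangle x y z : X x -> X y -> X z -> N (x - z) <= N (x - y) + N (y - z).
Proof.
move=> Xx Xy Xz; have -> : x - z = (x - y) + (y - z) by rewrite addrA subrK.
by apply: ND; apply: XD => //; exact: XN.
Qed.

(** A move of the rearrangement towards [v], when the terms of [s] have been used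
    already; [b] limits how far the partial sums go astray on the way. *)
Definition steer (v : V) (b : R) := forall (s : seq I) (d : R), 0 < d ->
  exists r : seq I, [/\ uniq r, {in r, forall k, k \notin s},
    N (psum r - v) <= d & forall m, N (psum (take m r)) <= b + d].

Lemma steerW v b b' : b <= b' -> steer v b -> steer v b'.
Proof.
move=> bb sv s d /(sv s)[r [ur rs rv rp]]; exists r; split=> // m.
by apply: le_trans (rp m) _; rewrite lerD2r.
Qed.

Lemma steer0 : steer 0 0.
Proof.
move=> s d d0; exists [::]; split=> //.
  by rewrite /psum big_nil subr0 N0 ltW.
by move=> m; rewrite /= /psum big_nil N0 add0r ltW.
Qed.

Lemma steerD v w b c e : X v -> X w -> b <= e -> N v + c <= e ->
  steer v b -> steer w c -> steer (v + w) e.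
Proof.
move=> Xv Xw be ce sv sw s d d0.
have d2 : 0 < d / 2 by rewrite divr_gt0.
have [r1 [u1 n1 v1 p1]] := sv s _ d2.
have [r2 [u2 n2 v2 p2]] := sw (s ++ r1) _ d2.
exists (r1 ++ r2); split.
- rewrite cat_uniq u1 u2 andbT /=; apply/hasPn => k /n2.
  by rewrite mem_cat negb_or => /andP[].
- move=> k; rewrite mem_cat => /orP[/n1 //|/n2].
  by rewrite mem_cat negb_or => /andP[].
- have -> : psum (r1 ++ r2) - (v + w) = (psum r1 - v) + (psum r2 - w).
    by rewrite psum_cat opprD addrACA.
  apply: (le_trans (ND _ _)); try by apply: XD; [exact: X_psum|exact: XN].
  by rewrite [leRHS](splitr d) lerD.
- move=> m; rewrite take_cat; case: ifP => _; first by have := p1 m; lra.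
  have -> : psum (r1 ++ take (m - size r1) r2) =
      ((psum r1 - v) + v) + psum (take (m - size r1) r2).
    by rewrite psum_cat subrK.
  have Xrv : X (psum r1 - v) by apply: XD; [exact: X_psum|exact: XN].
  apply: (le_trans (ND _ (X_psum _))); first exact: XD.
  have := ND Xrv Xv; have := p2 (m - size r1)%N; lra.
Qed.

Lemma steer_sum (J : Type) (js : seq J) (t : J -> V) (b : J -> R) :
  (forall j, X (t j)) -> (forall j, 0 <= b j) -> (forall j, N (t j) <= b j) ->
  (forall j, steer (t j) (b j)) ->
  steer (\sum_(j <- js) t j) (\sum_(j <- js) (b j *+ 2)).
Proof.
move=> Xt b0 Nb st; elim: js => [|j js IH]; first by rewrite !big_nil; exact: steer0.
rewrite !big_cons; apply: steerD (st j) IH => //.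
- exact: X_sum.
- rewrite mulr2n -addrA lerDl addr_ge0 // sumr_ge0 // => i _; exact: mulrn_wge0.
- by rewrite lerD2r; apply: le_trans (Nb j) _; rewrite mulr2n lerDl.
Qed.

Lemma steerMn q c j : X q -> 0 <= c -> steer q c -> steer (q *+ j) (N q *+ j + c).
Proof.
move=> Xq c0 sq; elim: j => [|j IH].
  by rewrite !mulr0n add0r; exact: steerW steer0.
rewrite mulrSr; apply: steerD IH sq => //.
- exact: X_Mn.
- by rewrite lerD2r ler_wpMn2l.
- by rewrite NMn // lerD2r ler_wpMn2l.
Qed.

Variables (J : Type) (t : J -> V) (w : J -> R).
Hypotheses (Xt : forall j, X (t j)) (w_ge0 : forall j, 0 <= w j)
  (Nt : forall j, N (t j) <= w j) (steer_t : forall j, steer (t j) (w j)).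
Hypothesis divt : forall (K : nat) j, (0 < K)%N ->
  exists j', t j' *+ K = t j /\ w j' *+ K = w j.

(** The target is cut into [K] equal parts, and the parts are approximated one
    after the other. While a part is being approximated the bound on the
    partial sums is only the crude one of [steer_sum], but this bound is
    divided by [K]. *)
Lemma steer_targets (js : seq J) (d : R) : 0 < d ->
  steer (\sum_(j <- js) t j) (N (\sum_(j <- js) t j) + d).
Proof.
move=> d0; pose W := \sum_(j <- js) (w j *+ 2).
have W0 : 0 <= W by apply: sumr_ge0 => j _; exact: mulrn_wge0.
pose K := (Num.truncn (W / d)).+1.
have WK : W <= d *+ K.
  by rewrite -mulr_natl -ler_pdivrMr // ltW // truncnS_gt.
have split_by (k : nat) : (0 < k)%N -> exists js', (\sum_(j <- js') t j) *+ k =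
    \sum_(j <- js) t j /\ (\sum_(j <- js') (w j *+ 2)) *+ k = W.
  move=> k0; rewrite /W; elim: js {W W0 K WK} => [|j js' [js1 [tE wE]]].
    by exists [::]; rewrite !big_nil !mul0rn.
  have [j' [t' w']] := divt j k0.
  exists (j' :: js1); rewrite !big_cons !mulrnDl tE wE t'; split=> //.
  by rewrite w'.
have [js' [tE wE]] := split_by K (ltn0Sn _).
set q := \sum_(j <- js') t j in tE; set W' := \sum_(j <- js') _ in wE.
have Xq : X q by exact: X_sum.
have W'0 : 0 <= W' by apply: sumr_ge0 => j _; exact: mulrn_wge0.
have sq : steer q W' by exact: steer_sum.
rewrite -tE NMn //; apply: steerW (steerMn K Xq W'0 sq).
rewrite lerD2l; move: WK; rewrite -wE lerMn2r /=.
by [].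
Qed.

Hypothesis dense_t : forall f (d : R), X f -> 0 < d ->
  exists js : seq J, N (f - \sum_(j <- js) t j) <= d.

(** The targets close to [f] have almost the norm of [f], and [f] is approached
    up to an arbitrary error only: both losses go into the error of [steer]. *)
Lemma steer_X f : X f -> steer f (N f).
Proof.
move=> Xf s d d0.
have d4 : 0 < d / 4 by rewrite divr_gt0.
have [js hjs] := dense_t Xf d4; set p := \sum_(j <- js) _ in hjs.
have Xp : X p by exact: X_sum.
have [r [ur rs rp rm]] := steer_targets js d4 s d4.
exists r; split=> // [|m].
  have := N_triangle (X_psum r) Xp Xf; rewrite -/p in rp.
  move: hjs; rewrite N_subC; lra.
apply: le_trans (rm m) _; rewrite -/p.
have := N_triangle Xp Xf X0; rewrite !subr0 N_subC; lra.
Qed.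

End Steering.

Section IntEnum.

(** The enumeration 0, -1, 1, -2, 2, ... of the integers. *)
Definition int_enum (n : nat) : int := if odd n then Negz n./2 else Posz n./2.

Definition int_rank (k : int) : nat :=
  match k with Posz n => n.*2 | Negz n => n.*2.+1 end.

Lemma int_enumK : cancel int_enum int_rank.
Proof.
move=> n; rewrite /int_enum; case: ifP => on /=; have := odd_double_half n; rewrite on.
  by rewrite add1n.
by rewrite add0n.
Qed.

Lemma int_rankK : cancel int_rank int_enum.
Proof. by case=> n; rewrite /int_enum /= odd_double /= ?uphalf_double ?doubleK. Qed.

End IntEnum.

Section Rearrangement.
Context {R : realType} {V : zmodType}.
Variables (X : set V) (N : V -> R) (u : int -> V).
Hypotheses (XD : forall x y, X x -> X y -> X (x + y))
  (XN : forall x, X x -> X (- x)) (X0 : X 0) (Xu : forall k, X (u k)).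
Hypotheses (ND : forall x y, X x -> X y -> N (x + y) <= N x + N y)
  (NN : forall x, N (- x) = N x) (N_ge0 : forall x, 0 <= N x).
Hypothesis steerX : forall f, X f -> steer N u f (N f).
Hypothesis Nu0 : forall e : R, 0 < e -> exists n0, forall n, (n0 <= n)%N -> N (u (int_enum n)) <= e.

Variable f : V.
Hypothesis Xf : X f.

Let S := psum u.
Let dist (s : seq int) := N (S s - f).
Let tail_size (m : nat) : R := 2^-1 ^+ m + N (u (int_enum m)).

(** First the residual is made small by [steerX]; then the integer of rank [m] is
    inserted unless it has been used, so that in the end none is left out. *)
Lemma stage (m : nat) (s : seq int) : uniq s -> exists s' : seq int,
  [/\ uniq (s ++ s'), int_enum m \in s ++ s', dist (s ++ s') <= tail_size m &
      forall k, dist (s ++ take k s') <= dist s *+ 2 + tail_size m].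
Proof.
move=> us.
have XS r : X (S r) by exact: X_psum.
have d0 : 0 < 2^-1 ^+ m :> R by rewrite exprn_gt0.
have [r [ur rs rv rp]] := steerX (XD Xf (XN (XS s))) s d0.
have usr : uniq (s ++ r).
  by rewrite cat_uniq us ur andbT /=; apply/hasPn => k /rs.
have dsr : dist (s ++ r) <= 2^-1 ^+ m.
  rewrite /dist /S psum_cat; apply: le_trans rv.
  by rewrite opprB addrA [psum u r + _]addrC.
have pre k : dist (s ++ take k r) <= dist s *+ 2 + 2^-1 ^+ m.
  rewrite /dist /S psum_cat addrAC.
  apply: (le_trans (ND (XD (XS s) (XN Xf)) (XS _))).
  have := rp k; rewrite -/S -(NN (f - _)) opprB mulr2n; lra.
have Nm := N_ge0 (u (int_enum m)).
have [inm|outm] := boolP (int_enum m \in s ++ r).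
  exists r; split=> // [|k]; first by rewrite /tail_size; lra.
  by rewrite /tail_size; have := pre k; lra.
exists (rcons r (int_enum m)); rewrite -rcons_cat; split.
- by rewrite rcons_uniq outm.
- by rewrite mem_rcons mem_head.
- rewrite /dist /S -cats1 psum_cat {2}/psum big_seq1 addrAC.
  apply: (le_trans (ND (XD (XS _) (XN Xf)) (Xu _))).
  by rewrite lerD2r.
- move=> k; rewrite -cats1 take_cat; case: ifP => _.
    by have := pre k; rewrite /tail_size; lra.
  case: (k - size r)%N => [|j] /=.
    rewrite cats0; have := pre (size r); rewrite take_size /tail_size; lra.
  rewrite catA /dist /S psum_cat {2}/psum big_seq1 addrAC.
  apply: (le_trans (ND (XD (XS _) (XN Xf)) (Xu _))).
  have := pre (size r); rewrite take_size /tail_size /dist /S; lra.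
Qed.

Lemma rearrangement : exists sigma : nat -> int, bijective sigma /\
  forall e : R, 0 < e -> exists n0, forall n, (n0 <= n)%N ->
    N (\sum_(j < n) u (sigma j) - f) <= e.
Proof.
have /choice[nxt nxtP] : forall ms : nat * seq int, exists s', uniq ms.2 ->
  [/\ uniq (ms.2 ++ s'), int_enum ms.1 \in ms.2 ++ s', dist (ms.2 ++ s') <= tail_size ms.1 &
      forall k, dist (ms.2 ++ take k s') <= dist ms.2 *+ 2 + tail_size ms.1].
  move=> [m s]; have [us|nus] := boolP (uniq s); last by exists [::].
  by have [s' hs'] := stage m us; exists s'.
(* [St m] lists the integers used in the first [m] stages. *)
pose fix St m := if m is k.+1 then St k ++ nxt (k, St k) else [::].
have uSt m : uniq (St m).
  by elim: m => [//|m IH] /=; case: (nxtP (m, St m) IH).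
have StP m := nxtP (m, St m) (uSt m).
have StD m d : exists t, St (m + d)%N = St m ++ t.
  elim: d => [|d [t IH]]; first by exists [::]; rewrite addn0 cats0.
  by rewrite addnS /= IH -catA; eexists.
have Stin m n : (m < n)%N -> int_enum m \in St n.
  move=> mn; have [t] := StD m.+1 (n - m.+1)%N; rewrite subnKC // => ->.
  by rewrite mem_cat; case: (StP m) => _ /= -> .
have Stsize n : (n <= size (St n))%N.
  have := @uniq_leq_size _ [seq int_enum m | m <- iota 0 n] (St n).
  rewrite size_map size_iota map_inj_uniq ?iota_uniq; last exact: can_inj int_enumK.
  apply=> // k /mapP[m]; rewrite mem_iota add0n => /andP[_ mn] ->; exact: Stin.
pose sigma n := nth 0 (St n.+1) n.
have sigmaE m n : (n < size (St m))%N -> nth 0 (St m) n = sigma n.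
  move=> nm; rewrite /sigma; have nn := Stsize n.+1.
  have [mn|mn] := leqP m n.+1.
    by have [t] := StD m (n.+1 - m)%N; rewrite subnKC // => ->; rewrite nth_cat nm.
  by have [t] := StD n.+1 (m - n.+1)%N; rewrite subnKC 1?ltnW // => ->; rewrite nth_cat nn.
have sumE m n : (n <= size (St m))%N -> \sum_(j < n) u (sigma j) = S (take n (St m)).
  move=> nm; rewrite /S /psum (big_nth 0) size_take_min (minn_idPl nm) big_mkord.
  apply: eq_bigr => j _; rewrite nth_take // sigmaE // (leq_trans _ nm) //.
exists sigma; split.
  exists (fun k => index k (St (int_rank k).+1)) => [n|k].
    have kin : sigma n \in St (int_rank (sigma n)).+1.
      by rewrite -[X in X \in _](int_rankK (sigma n)); exact: Stin.
    have nM := leq_maxl n.+1 (int_rank (sigma n)).+1.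
    have rM := leq_maxr n.+1 (int_rank (sigma n)).+1.
    set M := maxn _ _ in nM rM.
    have -> : index (sigma n) (St (int_rank (sigma n)).+1) = index (sigma n) (St M).
      have [t] := StD (int_rank (sigma n)).+1 (M - (int_rank (sigma n)).+1)%N.
      by rewrite subnKC // => ->; rewrite [RHS]index_cat kin.
    have nS : (n < size (St M))%N by apply: leq_trans (Stsize M).
    by rewrite -(sigmaE M) // index_uniq.
  have kin : k \in St (int_rank k).+1.
    by rewrite -[X in X \in _](int_rankK k); exact: Stin.
  by rewrite -(sigmaE (int_rank k).+1) ?nth_index // index_mem.
move=> e e0.
have e6 : 0 < e / 6 by rewrite divr_gt0.
have [n1 hn1] := Nu0 e6.
have [n2 hn2] : exists n2, forall n, (n2 <= n)%N -> 2^-1 ^+ n <= e / 6 :> R.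
  exists (Num.truncn (e / 6)^-1).+1 => n nn.
  rewrite exprVn -[leRHS]invrK lef_pV2 ?posrE ?exprn_gt0 ?invr_gt0 //.
  apply: (@le_trans _ _ n%:R); last by rewrite -natrX ler_nat ltnW // ltn_expl.
  by apply: le_trans (ltW (truncnS_gt _)) _; rewrite ler_nat.
pose m0 := maxn n1 n2.
have small m : (m0 <= m)%N -> tail_size m <= e / 3.
  rewrite geq_max => /andP[/hn1 h1 /hn2 h2]; rewrite /tail_size; lra.
exists (size (St m0.+1)) => n nn.
(* [n] terms end inside the stage of rank [m]. *)
have [m [mm0 mn nm]] : exists m, [/\ (m0 < m)%N, (size (St m) <= n)%N & (n < size (St m.+1))%N].
  have ex : exists i, (n < size (St (m0.+1 + i)%N))%N.
    by exists n.+1; apply: leq_trans (Stsize _); rewrite leq_addl.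
  case: (ex_minnP ex) => -[|i] hi mini.
    by rewrite addn0 ltnNge nn in hi.
  exists (m0.+1 + i)%N; split; first by rewrite ltn_addr.
    by rewrite leqNgt; apply/negP => /mini; rewrite ltnn.
  by rewrite -addnS.
rewrite (sumE m.+1 n (ltnW nm)).
case: m mm0 mn nm => [//|m] mm0 mn nm.
have StS k : St k.+1 = St k ++ nxt (k, St k) by [].
have [_ _ h1 _] := StP m; have [_ _ _ h2] := StP m.+1.
have := h2 (n - size (St m.+1))%N.
rewrite [_.1]/= [_.2]/= in h1 *; rewrite -StS in h1.
rewrite (StS m.+1) take_cat ltnNge mn [~~ _]/=; cbv iota; rewrite /dist.
have s1 := small m mm0; have s2 := small m.+1 (leqW mm0).
by move: h1; rewrite /dist mulr2n; lra.
Qed.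

End Rearrangement.

(** * The coefficients of the series *)

Section BlockSequence.
Context {R : realType}.

(** A frequency and a Gaussian rational coefficient. These pairs are countable,
    they can be divided by integers, and their exponentials span a dense set. *)
Definition target_index : Type := int * (rat * rat).

Definition target_coef (j : target_index) : R[i] := Complex (ratr j.2.1) (ratr j.2.2).

Definition target (j : target_index) : R -> R[i] :=
  fun x => target_coef j * cis (j.1%:~R * x).

(** Each target needs infinitely many blocks; the 2-adic valuation takes each
    value infinitely often. *)
Definition target_enum (n : nat) : target_index :=
  odflt (0, (0, 0)) (unpickle (logn 2 n)).

Lemma target_enum_often (j : target_index) (m : nat) :
  exists2 n, (m <= n)%N & target_enum n = j.
Proof.
exists (2 ^ pickle j * (2 * m).+1)%N.
  by rewrite -[m]mul1n leq_mul ?expn_gt0 //; lia.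
rewrite /target_enum lognM ?expn_gt0 // pfactorK // (_ : logn 2 (2 * m).+1 = 0)%N.
  by rewrite addn0 pickleK.
by apply/eqP; rewrite -leqn0 leqNgt logn_gt0 mem_primes /= dvdn2 /= mul2n odd_double.
Qed.

Lemma block_sequence : exists (B : nat -> seq (int * R[i])) (e : nat -> R -> R) (D : nat -> nat),
  [/\ forall n, (D n < D n.+1)%N,
      forall n (p : int * R[i]), p \in B n -> (`|p.1| <= D n.+1)%N &
      forall n, is_block n (D n) (target_enum n).1 (target_coef (target_enum n)) (B n) (e n)].
Proof.
have /choice[F FP] : forall nD : nat * nat, exists se : seq (int * R[i]) * (R -> R),
    is_block nD.1 nD.2 (target_enum nD.1).1 (target_coef (target_enum nD.1)) se.1 se.2.
  move=> [n D]; have [s [e h]] :=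
    block_exists n D (target_enum n).1 (target_coef (target_enum n)).
  by exists (s, e).
pose D := fix D n := if n is m.+1
  then maxn (D m).+1 (\max_(p <- (F (m, D m)).1) `|p.1|)%N else 0%N.
exists (fun n => (F (n, D n)).1), (fun n => (F (n, D n)).2), D; split=> n.
- exact: leq_maxl.
- move=> p pB; apply: leq_trans (leq_maxr _ _).
  exact: (leq_bigmax_seq (F := fun p : int * R[i] => `|p.1|%N) p).

- exact: FP.
Qed.

End BlockSequence.

Section Coefficients.
Context {R : realType}.
Variables (B : nat -> seq (int * R[i])) (D : nat -> nat).
Hypotheses (D_lt : forall n, (D n < D n.+1)%N)
  (band : forall n (p : int * R[i]), p \in B n -> (D n < `|p.1| <= D n.+1)%N)
  (uniqB : forall n, uniq [seq p.1 | p <- B n])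
  (B_small : forall n (q : R), 2 + n.+1%:R^-1 <= q ->
    \sum_(p <- B n) normc p.2 `^ q <= 2^-1 ^+ n).

(** A frequency that belongs to no block has coefficient 0, and its term is a
    member of the series all the same. *)
Definition series_coef (k : int) : R[i] := xget 0 [set c | exists n, (k, c) \in B n].

Lemma D_ge n : (n <= D n)%N.
Proof. by elim: n => [//|n IH]; exact: leq_ltn_trans (D_lt n). Qed.

Lemma D_mono m n : (m <= n)%N -> (D m <= D n)%N.
Proof.
move=> /subnKC <-; elim: (n - m)%N => [|d IH]; first by rewrite addn0.
by rewrite addnS (leq_trans IH) // ltnW.
Qed.

Lemma band_inj m n (p q : int * R[i]) : p \in B m -> q \in B n -> p.1 = q.1 -> m = n.
Proof.
move=> /band/andP[p1 p2] /band/andP[q1 q2] pq; rewrite pq in p1 p2.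
case: (ltngtP m n) => // /D_mono h.
- by have := leq_trans (leq_ltn_trans (leq_trans p2 h) q1) (leqnn _); rewrite ltnn.
- by have := leq_trans (leq_ltn_trans (leq_trans q2 h) p1) (leqnn _); rewrite ltnn.
Qed.

Lemma series_coefE n (p : int * R[i]) : p \in B n -> series_coef p.1 = p.2.
Proof.
case: p => k c pB; rewrite /series_coef /=.
case: xgetP => [y _ [m km]|/(_ c) []]; last by exists n.
have mn := band_inj km pB (erefl k); rewrite mn in km.
have ui i j : (i < size (B n))%N -> (j < size (B n))%N ->
    (nth (0, 0) (B n) i).1 = (nth (0, 0) (B n) j).1 -> i = j.
  move=> si sj h; apply/eqP; rewrite -(nth_uniq 0 _ _ (uniqB n)) ?size_map //.
  by rewrite !(nth_map (0, 0)) // h.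
have k1 : (index (k, y) (B n) < size (B n))%N by rewrite index_mem.
have k2 : (index (k, c) (B n) < size (B n))%N by rewrite index_mem.
have := ui _ _ k1 k2; rewrite !nth_index // => /(_ erefl) E.
by have := nth_index (0, 0) km; rewrite E nth_index // => -[].
Qed.

Lemma series_coef0 k : (forall n, k \notin [seq p.1 | p <- B n]) -> series_coef k = 0.
Proof.
move=> kn; rewrite /series_coef; case: xgetP => [y _ [n kB]|//].
by have := kn n; rewrite (map_f fst kB).
Qed.

Lemma sum_trig_terms n (s : seq (int * R[i])) : {subset s <= B n} ->
  psum (trig_term series_coef) [seq p.1 | p <- s] = trig_sum s.
Proof.
move=> sB; rewrite /psum big_map; apply/funext => x; rewrite fct_sumE /trig_sum.
rewrite !big_seq; apply: eq_bigr => p /sB pB.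
by rewrite /trig_term (series_coefE pB).
Qed.

Let power_sum (q : R) n := \sum_(p <- B n) normc p.2 `^ q.

Lemma power_sum_ge0 q n : 0 <= power_sum q n.
Proof. by apply: sumr_ge0 => p _; exact: powR_ge0. Qed.

Lemma order_below (q : R) : 2 < q ->
  exists nq : nat, forall n, (nq <= n)%N -> 2 + n.+1%:R^-1 <= q.
Proof.
move=> q2; have q20 : 0 < q - 2 by rewrite subr_gt0.
have [m hm] := exists_nat_ge (q - 2)^-1.
exists m => n mn; rewrite -lerBrDl -[leRHS]invrK lef_pV2 ?posrE ?invr_gt0 ?ltr0Sn //.
by apply: le_trans hm _; rewrite ler_nat ltnW.
Qed.

Lemma geometric_half_le (m n : nat) : \sum_(m <= i < n) 2^-1 ^+ i <= 2 :> R.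
Proof.
apply: (@le_trans _ _ (\sum_(0 <= i < n) 2^-1 ^+ i)).
  have [mn|nm] := leqP m n; last first.
    by rewrite big_geq ?(ltnW nm) // sumr_ge0 // => i _; rewrite exprn_ge0.
  by rewrite [leRHS](big_cat_nat (leq0n m) mn) /= lerDr sumr_ge0 // => i _; rewrite exprn_ge0.
have E : \sum_(0 <= i < n) 2^-1 ^+ i = 2 - 2 * 2^-1 ^+ n :> R.
  elim: n => [|n IH]; first by rewrite big_geq // expr0; ring.
  by rewrite big_nat_recr //= IH exprS; field.
by rewrite E lerBlDr lerDl mulr_ge0 // exprn_ge0.
Qed.

Lemma power_sums_bounded (q : R) : 2 < q ->
  exists M : R, forall n, \sum_(0 <= i < n) power_sum q i <= M.
Proof.
move=> /order_below[nq hq].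
exists (\sum_(0 <= i < nq) power_sum q i + 2) => n.
apply: (@le_trans _ _ (\sum_(0 <= i < maxn nq n) power_sum q i)).
  rewrite [leRHS](big_cat_nat (leq0n n) (leq_maxr _ _)) /= lerDl sumr_ge0 // => i _.
  exact: power_sum_ge0.
rewrite (big_cat_nat (leq0n nq) (leq_maxl _ _)) /= lerD2l.
apply: le_trans (geometric_half_le nq (maxn nq n)).
rewrite !big_nat; apply: ler_sum => i /andP[/hq h _]; exact: B_small.
Qed.

(** Up to the frequency [D n], nonzero coefficients come from the first [n]
    blocks. *)
Lemma finite_sum_le (q : R) (s : seq int) (n : nat) : q != 0 -> uniq s ->
  (forall k, k \in s -> (`|k| <= D n)%N) ->
  \sum_(k <- s) normc (series_coef k) `^ q <= \sum_(0 <= i < n) power_sum q i.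
Proof.
move=> q0 us sn.
pose L := flatten [seq [seq p.1 | p <- B i] | i <- iota 0 n].
have memL k : k \in L -> exists2 i, (i < n)%N & k \in [seq p.1 | p <- B i].
  move=> /flatten_mapP[j]; rewrite mem_iota add0n => /andP[_ hi] kB.
  by exists j.
have sumL : \sum_(k <- L) normc (series_coef k) `^ q = \sum_(0 <= i < n) power_sum q i.
  rewrite /L big_flatten big_map /index_iota subn0; apply: eq_bigr => i _.
  rewrite big_map /power_sum !big_seq; apply: eq_bigr => p pB.
  by rewrite (series_coefE pB).
have uL : uniq L.
  rewrite /L; elim: n {sn L memL sumL} => [//|n IH].
  rewrite -addn1 iotaD map_cat flatten_cat cat_uniq IH add0n /= cats0 uniqB andbT.
  apply/hasPn => _ /mapP[p pB ->]; apply/negP => /flatten_mapP[j].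
  rewrite mem_iota add0n => /andP[_ hi] /mapP[p' pB' E].
  by have := band_inj pB pB' E => ni; rewrite ni ltnn in hi.
rewrite -sumL (bigID (mem L)) /=.
have -> : \sum_(k <- s | k \notin L) normc (series_coef k) `^ q = 0.
  rewrite big_seq_cond big1 // => k /andP[ks kL].
  rewrite series_coef0 ?normc0 ?powR0 // => m; apply/negP => /mapP[p pB kp].
  move/negP: kL; apply; apply/flatten_mapP; exists m; last by rewrite kp map_f.
  rewrite mem_iota add0n /=; have /andP[d1 _] := band pB.
  have := leq_trans d1 _; rewrite -kp => /(_ _ (sn k ks)); rewrite ltnNge => /negP h.
  by rewrite ltnNge; apply/negP => /D_mono.
rewrite addr0 -big_filter [leRHS](bigID (mem s)) /=.
rewrite -[X in _ <= X + _]big_filter.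
have -> : \sum_(k <- [seq k <- s | k \in L]) normc (series_coef k) `^ q =
    \sum_(k <- [seq k <- L | k \in s]) normc (series_coef k) `^ q.
  apply: perm_big; apply: uniq_perm; rewrite ?filter_uniq // => k.
  by rewrite !mem_filter andbC.
by rewrite lerDl sumr_ge0 // => k _; exact: powR_ge0.
Qed.

Lemma esum_series_coef (q : R) : 2 < q ->
  (\esum_(k in [set: int]) (normc (series_coef k) `^ q)%:E < +oo)%E.
Proof.
move=> q2; have [M hM] := power_sums_bounded q2.
have q0 : q != 0 by rewrite gt_eqF // (lt_trans _ q2).
apply: (@le_lt_trans _ _ M%:E); last exact: ltry.
apply: ub_ereal_sup => _ [A [finA _] <-].
rewrite fsbig_finite //=; set s := finmap.enum_fset _.
rewrite sumEFin lee_fin.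
have us : uniq s by exact: finmap.fset_uniq.
apply: le_trans (hM (\max_(k <- s) `|k|)%N); apply: finite_sum_le => // k ks.
apply: leq_trans (D_ge _); exact: (leq_bigmax_seq (F := fun k : int => `|k|%N) k).
Qed.

(** High frequencies belong to late blocks, whose sums of cubes are small. *)
Lemma series_coef_small (d : R) : 0 < d ->
  exists m : nat, forall k : int, (m <= `|k|)%N -> normc (series_coef k) <= d.
Proof.
move=> d0.
have d3 : 0 < d ^+ 3 by rewrite exprn_gt0.
have [n hn] := exists_nat_ge (d ^+ 3)^-1.
exists (D n).+1 => k nk.
have [[m [c kB]]|nB] := pselect (exists m c, (k, c) \in B m); last first.
  rewrite series_coef0 ?normc0 ?(ltW d0) // => m; apply/negP => /mapP[[k' c] kB E].
  by apply: nB; exists m, c; rewrite E.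
rewrite (series_coefE kB) /=.
have nm : (n <= m)%N.
  have /andP[_ /= h] := band kB; rewrite leqNgt; apply/negP => /D_mono h'.
  by have := leq_trans nk (leq_trans h h'); rewrite ltnn.
have h3 : normc c ^+ 3 <= 2^-1 ^+ m.
  have q3 : 2 + m.+1%:R^-1 <= 3 :> R.
    have : m.+1%:R^-1 <= 1 :> R by rewrite invf_le1 ?ltr0Sn // ler1n.
    by move: (m.+1%:R^-1) => t; lra.
  apply: le_trans (B_small q3).
  rewrite (perm_big _ (perm_to_rem kB)) big_cons /= powR_mulrn ?normc_ge0 //.
  by rewrite lerDl sumr_ge0 // => p _; exact: powR_ge0.
rewrite -(@ler_pXn2r _ 3) ?nnegrE ?normc_ge0 ?(ltW d0) //.
apply: le_trans h3 _; rewrite exprVn -[leRHS]invrK lef_pV2 ?posrE ?exprn_gt0 ?invr_gt0 //.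
apply: le_trans hn _; rewrite -natrX ler_nat (leq_trans nm) // ltnW // ltn_expl //.
Qed.

End Coefficients.

(** * Density of the targets in the weighted space *)

Section WeightedSpace.
Context {R : realType}.
Variable mu : R -> R.
Hypotheses (mmu : measurable_fun (@period R) mu)
  (mu01 : forall x, period x -> 0 < mu x <= 1).

Let mu_ge0 x : period x -> 0 <= mu x. Proof. by move=> /mu01/andP[/ltW]. Qed.
Let mu_le1 x : period x -> mu x <= 1. Proof. by move=> /mu01/andP[]. Qed.
Let mu01' x : period x -> 0 <= mu x <= 1.
Proof. by move=> /mu01/andP[/ltW -> ->]. Qed.

Definition L1w_fnorm (f : R -> R[i]) : R := fine (L1w_norm mu f).
Local Notation X := (L1w mu).
Local Notation N := L1w_fnorm.

Lemma L1w_fnormE f : X f -> L1w_norm mu f = (N f)%:E.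
Proof.
by move=> [_ fin]; rewrite fineK // ge0_fin_numE //; exact: L1w_norm_ge0.
Qed.

Lemma L1w_fnorm_ge0 f : 0 <= N f.
Proof. by apply: fine_ge0; exact: L1w_norm_ge0. Qed.

Lemma L1wD f g : X f -> X g -> X (f + g).
Proof.
move=> Xf Xg; split; first by apply: cmeasurable_funD; [case: Xf|case: Xg].
apply: (le_lt_trans (L1w_normD mmu mu_ge0 _ _)); [by case: Xf|by case: Xg|].
by rewrite lte_add_pinfty //; [case: Xf|case: Xg].
Qed.

Lemma L1wN f : X f -> X (- f).
Proof. by move=> [mf fin]; split; [exact: cmeasurable_funN|rewrite L1w_normN]. Qed.

Lemma L1w_trig_sum s : X (trig_sum s).
Proof.
split; first exact: measurable_trig_sum.
apply: (le_lt_trans (L1w_norm_le1 mmu mu_ge0 mu_le1 (measurable_trig_sum s))).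
rewrite /L1w_norm; under eq_integral do rewrite mulr1.
rewrite integral_pint ?ltry //; exact: continuous_normc (ccontinuous_trig_sum s).
Qed.

Lemma L1w_term c (k : int) : X (fun x => c * cis (k%:~R * x)).
Proof.
have -> : (fun x => c * cis (k%:~R * x)) = trig_sum [:: (k, c)].
  by apply/funext => x; rewrite trig_sum_cons trig_sum_nil addr0.
exact: L1w_trig_sum.
Qed.

Lemma L1w_zero : X 0.
Proof. by rewrite -trig_sum_nil; exact: L1w_trig_sum. Qed.

Lemma L1w_fnorm0 : N 0 = 0.
Proof. by rewrite /L1w_fnorm L1w_norm0. Qed.

Lemma L1w_fnormN f : N (- f) = N f.
Proof. by rewrite /L1w_fnorm L1w_normN. Qed.

Lemma L1w_fnormD f g : X f -> X g -> N (f + g) <= N f + N g.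
Proof.
move=> Xf Xg; rewrite -lee_fin EFinD -!L1w_fnormE //; last exact: L1wD.
by apply: L1w_normD => //; [case: Xf|case: Xg].
Qed.

Lemma L1w_fnormMn f n : X f -> N (f *+ n) = N f *+ n.
Proof.
move=> Xf.
have -> : f *+ n = (fun x => n%:R * f x).
  by apply/funext => x; rewrite mulr_natl; elim: n => [|n IH]; rewrite ?mulr0n // !mulrS fctE IH.
rewrite {1}/L1w_fnorm L1w_normZ //; last by case: Xf.
by rewrite L1w_fnormE // -EFinM /= normcMn normc1 mulr_natl.
Qed.

Lemma L1w_fnorm_term c (k : int) : N (fun x => c * cis (k%:~R * x)) <= 2 * pi * normc c.
Proof.
rewrite -lee_fin -L1w_fnormE; last exact: L1w_term.
apply: (le_trans (L1w_norm_le1 mmu mu_ge0 mu_le1 _)); first by case: (L1w_term c k).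
rewrite /L1w_norm.
under eq_integral do rewrite mulr1 normcM normc_cis mulr1.
rewrite integral_cst; last exact: measurable_period.
by rewrite [X in (_ * X)%E]lebesgue_period -EFinM lee_fin mulrC.
Qed.

Lemma target_coef_dense (c : R[i]) (d : R) (k : int) : 0 < d ->
  exists2 j : target_index, j.1 = k & normc (c - target_coef j) <= d.
Proof.
move=> d0; case: c => a b.
have approx (x : R) : exists r : rat, `|x - ratr r| <= d / 2.
  have [|r] := @rat_in_itvoo R (x - d / 2) (x + d / 2).
    have d2 : 0 < d / 2 by rewrite divr_gt0.
    lra.
  rewrite in_itv /= => /andP[r1 r2]; exists r.
  by rewrite ler_norml; apply/andP; split; lra.
have [r hr] := approx a; have [r' hr'] := approx b.
exists (k, (r, r')) => //.
have -> : Complex a b - target_coef (k, (r, r')) =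
    (a - ratr r)%:C%C + 'i%C * (b - ratr r')%:C%C by exact: complexE.
apply: (le_trans (le_normcD _ _)); rewrite normcM !normc_real.
have -> : normc 'i%C = 1 :> R by rewrite /= expr0n add0r expr1n sqrtr1.
by rewrite mul1r [leRHS]splitr lerD.
Qed.

Lemma targets_dense f (d : R) : X f -> 0 < d ->
  exists js : seq target_index, N (f - \sum_(j <- js) target j) <= d.
Proof.
move=> Xf d0; have d2 : 0 < d / 2 by rewrite divr_gt0.
have [mf /(_ _ d2)[s hs]] := trig_approx_L1w mmu mu01' Xf.
have Xt js : X (\sum_(j <- js) @target R j).
  by apply: (X_sum L1w_zero L1wD) => j; exact: L1w_term.
have [js hjs] : exists js, N (trig_sum s - \sum_(j <- js) target j) <= d / 2.
  elim: s (d / 2) d2 {hs} => [|p s IH] r r0.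
    by exists [::]; rewrite trig_sum_nil big_nil subr0 L1w_fnorm0 ltW.
  have r2 : 0 < r / 2 by rewrite divr_gt0.
  have [js hjs] := IH _ r2.
  have rp : 0 < r / 2 / (2 * pi) by rewrite divr_gt0 // period_lt.
  have [j j1 hj] := target_coef_dense p.2 p.1 rp.
  exists (j :: js); rewrite big_cons.
  have -> : trig_sum (p :: s) - (target j + \sum_(i <- js) target i) =
      (fun x => (p.2 - target_coef j) * cis (p.1%:~R * x)) +
      (trig_sum s - \sum_(i <- js) target i).
    apply/funext => x; rewrite !fctE trig_sum_cons /target j1 mulrBl; ring.
  apply: (le_trans (L1w_fnormD _ _)).
  - exact: L1w_term.
  - by apply: L1wD; [exact: L1w_trig_sum|exact: L1wN].
  - rewrite [leRHS]splitr lerD //; apply: le_trans (L1w_fnorm_term _ _) _.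
    by rewrite mulrC -ler_pdivlMr ?period_lt.
exists js.
have -> : f - \sum_(j <- js) target j = (f - trig_sum s) + (trig_sum s - \sum_(j <- js) target j).
  by rewrite addrA subrK.
have X1 : X (f - trig_sum s) by apply: L1wD => //; apply: L1wN; exact: L1w_trig_sum.
have X2 : X (trig_sum s - \sum_(j <- js) @target R j).
  by apply: L1wD; [exact: L1w_trig_sum|exact: L1wN].
apply: (le_trans (L1w_fnormD X1 X2)); rewrite [leRHS]splitr lerD //.
by rewrite -lee_fin -L1w_fnormE.
Qed.

End WeightedSpace.

(** * Universality *)

Section Universality.
Context {R : realType}.
Variables (B : nat -> seq (int * R[i])) (e : nat -> R -> R) (D : nat -> nat).
Hypotheses (D_lt : forall n, (D n < D n.+1)%N)
  (D_ub : forall n (p : int * R[i]), p \in B n -> (`|p.1| <= D n.+1)%N)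
  (blockB : forall n,
     is_block n (D n) (target_enum n).1 (target_coef (target_enum n)) (B n) (e n)).

Let band n (p : int * R[i]) : p \in B n -> (D n < `|p.1| <= D n.+1)%N.
Proof. by move=> pB; have [[_ h _ _] _] := blockB n; rewrite h // (D_ub pB). Qed.

Let uniqB n : uniq [seq p.1 | p <- B n].
Proof. by have [[]] := blockB n. Qed.

Let B_small n (q : R) : 2 + n.+1%:R^-1 <= q -> \sum_(p <- B n) normc p.2 `^ q <= 2^-1 ^+ n.
Proof. by have [[_ _ h _] _] := blockB n; exact: h. Qed.

Variables (mu : R -> R) (n0 : nat).
Hypotheses (mmu : measurable_fun (@period R) mu)
  (mu01 : forall x, period x -> 0 < mu x <= 1).
Hypothesis tame : forall n, (n0 <= n)%N ->
  (\int[lebesgue_measure]_(x in period) (e n x * mu x)%:E <= (2 * pi * 2^-1 ^+ n)%:E)%E.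

Let u := trig_term (series_coef B).

(** Late blocks for the target [j] can be placed beyond any finite set of
    frequencies, and their error is as small as required. *)
Lemma steer_target (j : target_index) :
  steer (L1w_fnorm mu) u (target j) (6 * pi * normc (target_coef j : R[i])).
Proof.
move=> s d d0.
have pi0 := @pi_gt0 R.
have [m hm] := exists_nat_ge (2 * pi / d).
pose n1 := maxn n0 (maxn m (\max_(k <- s) `|k|)%N).
have [n nn1 nj] := target_enum_often j n1.
have [nn0 nm ns] : [/\ (n0 <= n)%N, (m <= n)%N & (\max_(k <- s) `|k| <= n)%N].
  by move: nn1; rewrite !geq_max => /andP[? /andP[]].
have := blockB n; rewrite nj => -[[_ h1 _ h2] [ce e0 he _]].
exists [seq p.1 | p <- B n]; split.
- exact: uniqB.
- move=> k /mapP[p pB ->]; apply/negP => ps.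
  have /andP[d1 _] := band pB; have := D_ge D_lt n.
  have hmax : (`|p.1| <= \max_(k <- s) `|k|)%N.
    exact: (leq_bigmax_seq (F := fun k : int => `|k|%N) p.1).
  move=> h; have := leq_ltn_trans (leq_trans hmax (leq_trans ns h)) d1.
  by rewrite ltnn.
- rewrite (sum_trig_terms D_lt band uniqB (fun p h => h)).
  have Xd : L1w mu (trig_sum (B n) - target j).
    apply: L1wD => //; first exact: L1w_trig_sum.
    by apply: L1wN; exact: L1w_term.
  rewrite -lee_fin -L1w_fnormE //.
  have -> : L1w_norm mu (trig_sum (B n) - target j) =
      (\int[lebesgue_measure]_(x in period) (e n x * mu x)%:E)%E.
    by apply: eq_integral => x _; rewrite -he.
  apply: le_trans (tame nn0) _; rewrite lee_fin exprVn ler_pdivrMr ?exprn_gt0 //.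
  rewrite -ler_pdivrMl // mulrC (le_trans hm) // -natrX ler_nat (leq_trans nm) //.
  by rewrite ltnW // ltn_expl.
- move=> m'; rewrite -map_take (sum_trig_terms D_lt band uniqB (n := n)); last first.
    by move=> p /mem_take.
  rewrite -lee_fin -L1w_fnormE //; last exact: L1w_trig_sum.
  apply: (@le_trans _ _ (6 * pi * normc (target_coef j))%:E); last by rewrite lee_fin lerDl ltW.
  apply: le_trans (h2 m').
  apply: L1w_norm_le1 => //; [by move=> x /mu01/andP[/ltW]|by move=> x /mu01/andP[]|].
  exact: measurable_trig_sum.
Qed.

Lemma L1w_trig_term k : L1w mu (u k).
Proof. exact: L1w_term. Qed.

Lemma fnorm_trig_term_small (d : R) : 0 < d ->
  exists m, forall n, (m <= n)%N -> L1w_fnorm mu (u (int_enum n)) <= d.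
Proof.
move=> d0; have dp : 0 < d / (2 * pi) by rewrite divr_gt0 // period_lt.
have [m hm] := series_coef_small D_lt band uniqB B_small dp.
exists m.*2 => n mn; apply: (le_trans (L1w_fnorm_term mmu mu01 _ _)).
rewrite mulrC -ler_pdivlMr ?period_lt //; apply: hm.
have : (m <= n./2)%N by rewrite -(doubleK m) half_leq.
by rewrite /int_enum; case: ifP => _ //= h; rewrite (leq_trans h).
Qed.

(** Dividing the coefficient by [K] divides both the target and the bound on its
    blocks. *)
Lemma target_split (K : nat) (j : target_index) : (0 < K)%N ->
  exists j' : target_index, target j' *+ K = target j :> (R -> R[i]) /\
    (6 * pi * normc (target_coef j' : R[i])) *+ K = 6 * pi * normc (target_coef j : R[i]).
Proof.
move=> K0; case: j => l [a b].
have K0' : K%:R != 0 :> rat by rewrite pnatr_eq0 -lt0n.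
have E : @target_coef R (l, (a / K%:R, b / K%:R)) *+ K = target_coef (l, (a, b)).
  have part (r : rat) : ratr (r / K%:R) *+ K = ratr r :> R.
    by rewrite -[LHS]mulr_natr -(ratr_nat R K) -rmorphM /= divfK.
  have muln (x y : R) n : Complex x y *+ n = Complex (x *+ n) (y *+ n).
    by elim: n => [|n IH]; rewrite ?mulr0n // !mulrS IH.
  by rewrite /target_coef /= muln !part.
exists (l, (a / K%:R, b / K%:R)); split.
  have fMn (f : R -> R[i]) n x : (f *+ n) x = f x *+ n.
    by elim: n => [|n IH]; rewrite ?mulr0n // !mulrS fctE IH.
  by apply/funext => x; rewrite fMn /target -mulrnAl E.
by rewrite -mulrnAr -normcMn E.
Qed.

Lemma universal_series : universal_wrt_rearrangements (L1w mu) (L1w_norm mu) u.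
Proof.
move=> f Xf.
have mu0 x : period x -> 0 <= mu x by move=> /mu01/andP[/ltW].
have X0 := L1w_zero mmu mu01.
have XD := @L1wD R mu mmu mu01.
have XN := @L1wN R mu.
have ND := @L1w_fnormD R mu mmu mu01.
have NN := @L1w_fnormN R mu.
have N_ge0 := @L1w_fnorm_ge0 R mu mu01.
have NMn := @L1w_fnormMn R mu mmu mu01.
have Xt j : L1w mu (@target R j) by exact: L1w_term.
have pi0 := @pi_gt0 R.
have w0 j : 0 <= 6 * pi * normc (target_coef j : R[i]).
  by rewrite mulr_ge0 ?normc_ge0 // mulr_ge0 // ltW.
have Nt j : L1w_fnorm mu (@target R j) <= 6 * pi * normc (target_coef j : R[i]).
  apply: (le_trans (L1w_fnorm_term mmu mu01 _ _)).
  rewrite ler_wpM2r ?normc_ge0 //; lra.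
have steerX g : L1w mu g -> steer (L1w_fnorm mu) u g (L1w_fnorm mu g).
  apply: (steer_X X0 XD XN L1w_trig_term (L1w_fnorm0 mu) N_ge0 ND NN NMn Xt w0 Nt).
  - exact: steer_target.
  - exact: target_split.
  - by move=> h d Xh; exact: targets_dense.
have [sigma [bs cs]] := rearrangement XD XN X0 L1w_trig_term ND NN N_ge0 steerX
  fnorm_trig_term_small Xf.
exists sigma; split=> //.
have Xs n : L1w mu (\sum_(j < n) u (sigma j) - f).
  apply: (XD); last exact: XN.
  by apply: (X_sum X0 XD) => j; exact: L1w_trig_term.
have -> : (fun n : nat => L1w_norm mu (\sum_(j < n) u (sigma j) - f)) =
    (fun n => (L1w_fnorm mu (\sum_(j < n) u (sigma j) - f))%:E).
  by apply/funext => n; rewrite L1w_fnormE.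
apply: cvg_EFin; first by apply: nearW.
apply/cvgrPdist_le => d d0; have [m hm] := cs d d0.
exists m => // n /= mn; rewrite sub0r normrN ger0_norm //; exact: hm.
Qed.

End Universality.

Theorem theorem1p4 (R : realType) :
  exists C : int -> R[i],
    (forall q : R, 2 < q ->
       (\esum_(k in [set: int]) ((normc (C k) `^ q)%R)%:E < +oo)%E) /\
    (forall eps : R, 0 < eps ->
       exists mu : R -> R,
         [/\ measurable_fun (@period R) mu,
             (forall x : R, period x -> 0 < mu x <= 1),
             (lebesgue_measure (period `&` [set x | (mu x <> 1)%R]) < eps%:E)%E
           & universal_wrt_rearrangements (L1w mu) (L1w_norm mu) (trig_term C)]).
Proof.
have [B [e [D [D_lt D_ub blockB]]]] := @block_sequence R.
have band n (p : int * R[i]) : p \in B n -> (D n < `|p.1| <= D n.+1)%N.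
  by move=> pB; have [[_ h _ _] _] := blockB n; rewrite h // (D_ub n p pB).
have uniqB n : uniq [seq p.1 | p <- B n] by have [[]] := blockB n.
have B_small n (q : R) : 2 + n.+1%:R^-1 <= q -> \sum_(p <- B n) normc p.2 `^ q <= 2^-1 ^+ n.
  by have [[_ _ h _] _] := blockB n; exact: h.
exists (series_coef B); split=> [q q2|eps eps0].
  exact: (esum_series_coef D_lt band uniqB B_small q2).
have [n0 hn0] := exists_nat_ge (2 / eps).
pose delta : R := 2 / 2 ^+ n0.+1.
have delta_lt : delta < eps.
  rewrite ltr_pdivrMr ?exprn_gt0 // mulrC -ltr_pdivrMr // (le_lt_trans hn0) //.
  by rewrite -natrX ltr_nat ltnW // ltn_expl.
have ce k : continuous (e (n0.+1 + k)%N) by have [_ []] := blockB (n0.+1 + k)%N.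
have e_ge0 k x : 0 <= e (n0.+1 + k)%N x by have [_ []] := blockB (n0.+1 + k)%N.
have tau_gt0 k : 0 < 2^-1 ^+ (n0.+1 + k) :> R by rewrite exprn_gt0.
have delta_ge0 : 0 <= delta by rewrite divr_ge0 // exprn_ge0.
have small_bad k : (lebesgue_measure (period `&`
    [set x | (2^-1 ^+ (n0.+1 + k) < e (n0.+1 + k)%N x)%R]) <= (delta / 2 ^+ k.+1)%:E)%E.
  have -> : delta / 2 ^+ k.+1 = 2^-1 ^+ (n0.+1 + k).
    rewrite /delta -mulrA -invfM -exprD addnS exprS invfM mulrA divff // mul1r.
    by rewrite exprVn.
  by have [_ []] := blockB (n0.+1 + k)%N.
pose mu : R -> R :=
  taming_weight (fun k => e (n0.+1 + k)%N) (fun k => 2^-1 ^+ (n0.+1 + k)).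
have mu01 x : period x -> 0 < mu x <= 1 by move=> _; exact: taming_weight01.
have mmu : measurable_fun (@period R) mu by exact: measurable_taming_weight.
exists mu; split=> //.
- apply: le_lt_trans (taming_weight_neq1 ce tau_gt0 delta_ge0 small_bad) _.
  by rewrite lte_fin.
- apply: (universal_series D_lt D_ub blockB (n0 := n0.+1)) => // n nn0.
  rewrite -(subnKC nn0).
  exact: (taming_weightP ce e_ge0 tau_gt0 delta_ge0 small_bad).
Qed.
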